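(* Consider the plant $\dot x=f(x,u)$ with $f$ satisfying Assumption 1, a DT control law $U:\mathbb{R}^n\times[0,\infty)\to\mathbb{R}^m$, and the CT control $u_c(x):=U(x,0)$, with $u_c$ satisfying Assumption 2. Suppose that $U$ is StL and that the pair $(U_c,U)$ is StC, where $U_c(x,T):=u_c(x)$ for all $T\ge0$. Let $\bar F^e_U(x,T):=F^e(x,U(x,T),T)$ be the exact closed-loop DT model. Then the CT closed-loop system $\dot x=h(x):=f(x,u_c(x))$ is: (a) LES if and only if $\bar F^e_U$ is LES-VSR; (b) GALES if and only if $\bar F^e_U$ is SLES-VSR; (c) GES if and only if $\bar F^e_U$ is SES-VSR.
   Context: Assumption 1: $f:\mathbb{R}^n\times\mathbb{R}^m\to\mathbb{R}^n$ satisfies $f(0,0)=0$ and for every $M,M_u\ge0$ there is $L>0$ with $|f(x,u)-f(y,v)|\le L(|x-y|+|u-v|)$ for all $|x|,|y|\le M$, $|u|,|v|\le M_u$. Assumption 2: $u_c:\mathbb{R}^n\to\mathbb{R}^m$ satisfies $u_c(0)=0$ and for every $M\ge0$ there is $L>0$ with $|u_c(x)-u_c(y)|\le L|x-y|$ for all $|x|,|y|\le M$. Exact DT model: $F^e(x,u,T)$ is the value at time $T$ of the solution of $\dot z=f(z,u)$ (with $u$ held constant) with $z(0)=x$, i.e. $F^e(x,u,T)=x+\int_0^Tf(F^e(x,u,s),u)\,ds$. Solutions of a closed-loop DT model $\bar F$ under $\{T_i\}$: $x_{k+1}=\bar F(x_k,T_k)$. $\Phi(T)$: set of sequences $\{T_i\}_{i\ge0}$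 with $T_i\in(0,T)$; $\sum_{i=0}^{-1}T_i=0$. $\mathcal{K},\mathcal{K}_\infty,\mathcal{KL}$: standard comparison function classes. CT stability of $\dot x=h(x)$: GAS if there is $\beta\in\mathcal{KL}$ with $|x(t)|\le\beta(|x_0|,t)$ for all $x_0$, $t\ge0$; GES if moreover $\beta(r,t)=Kre^{-\lambda t}$ with $K\ge1,\lambda>0$; LES if there exist $K\ge1$, $R,\lambda>0$ with $|x(t)|\le K|x_0|e^{-\lambda t}$ for all $|x_0|\le R$, $t\ge0$; GALES if GAS and LES. StL: $U$ is StL if for each $M\ge0$ there exist $K(M)>0$, $T^*(M)>0$ ($T^*$ nonincreasing) such that for all $|x|,|y|\le M$, $T\in[0,T^* )$: $U(0,T)=0$ and $|U(x,T)-U(y,T)|\le K|x-y|$. StC: $(U,V)$ is StC if for each $M\ge0$ there exist $\rho\in\mathcal{K}_\infty$, $T^*(M)>0$ with $|U(x,T)-V(x,T)|\le\rho(T)|x|$ for all $|x|\le M$, $T\in[0,T^* )$. DT stability (VSR): SPS-VSR: there is $\beta\in\mathcal{KL}$ such that for all $M\ge0,R>0$ there is $T^\star(M,R)>0$ with $|x_k|\le\beta(|x_0|,\sum_{i=0}^{k-1}T_i)+R$ for all $k$, $\{T_i\}\in\Phi(T^\star)$, $|x_0|\le M$. LES-VSR: there exist $K\ge1$, $R,T^\star,\lambda>0$ with $|x_k|\le K|x_0|e^{-\lambda\sum_{i=0}^{k-1}T_i}$ for all $k$, $\{T_i\}\in\Phi(T^\star)$, $|x_0|\le R$. SLES-VSR: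 SPS-VSR and LES-VSR. SES-VSR: there exist $K\ge1,\lambda>0$ such that for each $M\ge0$ there is $T^\star(M)>0$ with $|x_k|\le K|x_0|e^{-\lambda\sum_{i=0}^{k-1}T_i}$ for all $k$, $\{T_i\}\in\Phi(T^\star)$, $|x_0|\le M$. *)

(* Defs.v *)
From HB Require Import structures.
From mathcomp Require Import all_boot all_order all_algebra.
From mathcomp Require Import all_classical all_reals all_analysis.
Set Implicit Arguments. Unset Strict Implicit. Unset Printing Implicit Defensive.
Import Order.TTheory GRing.Theory Num.Theory.
Import numFieldNormedType.Exports.
Local Open Scope classical_set_scope.
Local Open Scope ring_scope.

Section Defs.
Variable R : realType.

Definition enorm (n : nat) (x : 'rV[R]_n) : R :=
  Num.sqrt (\sum_(i < n) (x ord0 i) ^+ 2).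

Definition classK (a : R -> R) : Prop :=
  a 0 = 0 /\
  {within [set r : R | 0 <= r], continuous a} /\
  (forall r s, 0 <= r -> r < s -> a r < a s).

Definition classKinf (a : R -> R) : Prop :=
  classK a /\ (forall M : R, exists r, 0 <= r /\ M < a r).

Definition classKL (b : R -> R -> R) : Prop :=
  {within [set p : R * R | 0 <= p.1 /\ 0 <= p.2], continuous (fun p => b p.1 p.2)} /\
  (forall t, 0 <= t -> classK (fun r => b r t)) /\
  (forall r, 0 <= r ->
     (forall s t, 0 <= s -> s <= t -> b r t <= b r s) /\
     (fun t => b r t) @ +oo --> (0 : R)).

Definition is_sol (n : nat) (g : 'rV[R]_n -> 'rV[R]_n) (x0 : 'rV[R]_n) (T : R)
    (phi : R -> 'rV[R]_n) : Prop :=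
  phi 0 = x0 /\
  {within [set t : R | 0 <= t <= T], continuous phi} /\
  (forall t, 0 < t < T -> is_derive t 1 phi (g (phi t))).

(* Exact DT model F^e(x,u,T): value at time T of the solution of z' = f(z,u)
   (u constant), z(0) = x. (Under Assumption 1 this solution is unique when
   it exists; when it does not exist on [0,T] the value defaults to x.) *)
Definition Fe (n m : nat) (f : 'rV[R]_n -> 'rV[R]_m -> 'rV[R]_n)
    (x : 'rV[R]_n) (u : 'rV[R]_m) (T : R) : 'rV[R]_n :=
  xget x [set y | exists phi, is_sol (fun z => f z u) x T phi /\ phi T = y].

Definition assumption1 (n m : nat) (f : 'rV[R]_n -> 'rV[R]_m -> 'rV[R]_n) : Prop :=
  f 0 0 = 0 /\
  forall M Mu : R, 0 <= M -> 0 <= Mu -> exists L : R, 0 < L /\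
    forall x y u v, enorm x <= M -> enorm y <= M -> enorm u <= Mu -> enorm v <= Mu ->
      enorm (f x u - f y v) <= L * (enorm (x - y) + enorm (u - v)).

Definition assumption2 (n m : nat) (uc : 'rV[R]_n -> 'rV[R]_m) : Prop :=
  uc 0 = 0 /\
  forall M : R, 0 <= M -> exists L : R, 0 < L /\
    forall x y, enorm x <= M -> enorm y <= M -> enorm (uc x - uc y) <= L * enorm (x - y).

Definition StL (n m : nat) (U : 'rV[R]_n -> R -> 'rV[R]_m) : Prop :=
  exists (K Ts : R -> R),
    (forall M1 M2, 0 <= M1 -> M1 <= M2 -> Ts M2 <= Ts M1) /\
    forall M, 0 <= M -> 0 < K M /\ 0 < Ts M /\
      forall x y T, enorm x <= M -> enorm y <= M -> 0 <= T -> T < Ts M ->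
        U 0 T = 0 /\ enorm (U x T - U y T) <= K M * enorm (x - y).

Definition StC (n m : nat) (U V : 'rV[R]_n -> R -> 'rV[R]_m) : Prop :=
  forall M, 0 <= M -> exists (rho : R -> R) (Ts : R), classKinf rho /\ 0 < Ts /\
    forall x T, enorm x <= M -> 0 <= T -> T < Ts ->
      enorm (U x T - V x T) <= rho T * enorm x.

Definition GAS (n : nat) (h : 'rV[R]_n -> 'rV[R]_n) : Prop :=
  exists b, classKL b /\
    forall x0 T phi, 0 <= T -> is_sol h x0 T phi ->
      forall t, 0 <= t <= T -> enorm (phi t) <= b (enorm x0) t.

Definition GES (n : nat) (h : 'rV[R]_n -> 'rV[R]_n) : Prop :=
  exists K lam : R, 1 <= K /\ 0 < lam /\
    forall x0 T phi, 0 <= T -> is_sol h x0 T phi ->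
      forall t, 0 <= t <= T -> enorm (phi t) <= K * enorm x0 * expR (- lam * t).

Definition LES (n : nat) (h : 'rV[R]_n -> 'rV[R]_n) : Prop :=
  exists K Rr lam : R, 1 <= K /\ 0 < Rr /\ 0 < lam /\
    forall x0 T phi, enorm x0 <= Rr -> 0 <= T -> is_sol h x0 T phi ->
      forall t, 0 <= t <= T -> enorm (phi t) <= K * enorm x0 * expR (- lam * t).

Definition GALES (n : nat) (h : 'rV[R]_n -> 'rV[R]_n) : Prop := GAS h /\ LES h.

Fixpoint dt_sol (n : nat) (Fb : 'rV[R]_n -> R -> 'rV[R]_n) (Ts : nat -> R)
    (x0 : 'rV[R]_n) (k : nat) : 'rV[R]_n :=
  match k with
  | 0%N => x0
  | k'.+1 => Fb (dt_sol Fb Ts x0 k') (Ts k')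
  end.

Definition inPhi (T : R) (Ts : nat -> R) : Prop := forall i, 0 < Ts i < T.

Definition tsum (Ts : nat -> R) (k : nat) : R := \sum_(i < k) Ts i.

Definition SPS_VSR (n : nat) (Fb : 'rV[R]_n -> R -> 'rV[R]_n) : Prop :=
  exists b, classKL b /\
    forall M Rr : R, 0 <= M -> 0 < Rr -> exists Tst : R, 0 < Tst /\
      forall k Ts x0, inPhi Tst Ts -> enorm x0 <= M ->
        enorm (dt_sol Fb Ts x0 k) <= b (enorm x0) (tsum Ts k) + Rr.

Definition LES_VSR (n : nat) (Fb : 'rV[R]_n -> R -> 'rV[R]_n) : Prop :=
  exists K Rr Tst lam : R, 1 <= K /\ 0 < Rr /\ 0 < Tst /\ 0 < lam /\
    forall k Ts x0, inPhi Tst Ts -> enorm x0 <= Rr ->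
      enorm (dt_sol Fb Ts x0 k) <= K * enorm x0 * expR (- lam * tsum Ts k).

Definition SLES_VSR (n : nat) (Fb : 'rV[R]_n -> R -> 'rV[R]_n) : Prop :=
  SPS_VSR Fb /\ LES_VSR Fb.

Definition SES_VSR (n : nat) (Fb : 'rV[R]_n -> R -> 'rV[R]_n) : Prop :=
  exists K lam : R, 1 <= K /\ 0 < lam /\
    forall M : R, 0 <= M -> exists Tst : R, 0 < Tst /\
      forall k Ts x0, inPhi Tst Ts -> enorm x0 <= M ->
        enorm (dt_sol Fb Ts x0 k) <= K * enorm x0 * expR (- lam * tsum Ts k).

End Defs.

(* Main.v *)
(* Both implications rest on one comparison: on a bounded time horizon, a
   sampled trajectory with small enough steps stays within [eps * b] of a
   continuous closed-loop solution whose norm is at most [b], because each step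
   adds to the error a term proportional to [b] and Gronwall propagates it.
   From discrete to continuous time, sample ever faster and pass to the limit in
   the bound.  From continuous to discrete time, follow the solution over a
   horizon on which its bound contracts and restart from the sampled state.
   Norms of vector-valued functions are estimated coordinatewise, so that only
   scalar mean value arguments occur; solutions are obtained by Picard iteration
   after clamping the coordinates, which makes the field globally Lipschitz. *)

Require Import Defs.
From HB Require Import structures.
From mathcomp Require Import all_boot all_order all_algebra.
From mathcomp Require Import all_classical all_reals all_analysis.
From mathcomp Require Import ring lra.
Set Implicit Arguments. Unset Strict Implicit. Unset Printing Implicit Defensive.
Import Order.TTheory GRing.Theory Num.Theory.
Import numFieldNormedType.Exports.
Local Open Scope classical_set_scope.
Local Open Scope ring_scope.

(** * Euclidean norm of row vectors *)

Section euclidean_norm.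
Context {R : realType}.

Lemma enorm_ge0 (n : nat) (x : 'rV[R]_n) : 0 <= enorm x.
Proof. exact: sqrtr_ge0. Qed.

Lemma enorm_sqr (n : nat) (x : 'rV[R]_n) :
  enorm x ^+ 2 = \sum_(i < n) x ord0 i ^+ 2.
Proof. by rewrite sqr_sqrtr// sumr_ge0// => i _; exact: sqr_ge0. Qed.

Lemma enorm0 (n : nat) : enorm (0 : 'rV[R]_n) = 0.
Proof. by rewrite /enorm big1 ?sqrtr0// => i _; rewrite mxE expr0n. Qed.

Lemma enormN (n : nat) (x : 'rV[R]_n) : enorm (- x) = enorm x.
Proof. by congr Num.sqrt; apply: eq_bigr => i _; rewrite mxE sqrrN. Qed.

Lemma enormBC (n : nat) (x y : 'rV[R]_n) : enorm (x - y) = enorm (y - x).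
Proof. by rewrite -enormN opprB. Qed.

Lemma coord_le_enorm (n : nat) (x : 'rV[R]_n) i : `|x ord0 i| <= enorm x.
Proof.
rewrite -(@ler_pXn2r _ 2)// ?nnegrE ?enorm_ge0// enorm_sqr real_normK ?num_real//.
by rewrite (bigD1 i)//= lerDl sumr_ge0// => j _; exact: sqr_ge0.
Qed.

(** The crude factor [n.+1] replaces the square root of [n]; it is positive even in dimension 0, so
    later constants may divide by it. *)
Lemma enorm_le_coord (n : nat) (x : 'rV[R]_n) c : 0 <= c ->
  (forall i, `|x ord0 i| <= c) -> enorm x <= n.+1%:R * c.
Proof.
move=> c0 xc; rewrite -(@ler_pXn2r _ 2)// ?nnegrE ?enorm_ge0 ?mulr_ge0//.
rewrite enorm_sqr (@le_trans _ _ (\sum_(i < n) c ^+ 2))//.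
  by apply: ler_sum => i _; rewrite -(real_normK (num_real _)) lerXn2r ?nnegrE.
rewrite sumr_const card_ord exprMn -[leLHS]mulr_natl ler_wpM2r ?sqr_ge0//.
by rewrite -natrX ler_nat (leq_trans (leqnSn n))// -[leqLHS]muln1 expnS leq_mul.
Qed.

Lemma enorm_eq0 (n : nat) (x : 'rV[R]_n) : enorm x = 0 -> x = 0.
Proof.
move=> x0; apply/rowP => i; apply/eqP; rewrite mxE -normr_le0 -x0.
exact: coord_le_enorm.
Qed.

(** Weighting the coordinatewise AM-GM inequality by the ratio of the two norms makes its sum
    exactly the square of [enorm x + enorm y]. Vanishing norms are split off because the weights
    divide by them. *)
Lemma enormD (n : nat) (x y : 'rV[R]_n) : enorm (x + y) <= enorm x + enorm y.
Proof.
have [/enorm_eq0 ->|x0] := eqVneq (enorm x) 0; first by rewrite add0r lerDr enorm_ge0.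
have [/enorm_eq0 ->|y0] := eqVneq (enorm y) 0; first by rewrite addr0 lerDl enorm_ge0.
have xp : 0 < enorm x by rewrite lt0r x0 enorm_ge0.
have yp : 0 < enorm y by rewrite lt0r y0 enorm_ge0.
set a := enorm x in x0 xp *; set b := enorm y in y0 yp *.
rewrite -(@ler_pXn2r _ 2)// ?nnegrE ?enorm_ge0 ?addr_ge0 ?enorm_ge0//.
rewrite enorm_sqr.
(* AM-GM: [2 s t <= (b / a) s^2 + (a / b) t^2] *)
have amgm i : (x + y) ord0 i ^+ 2 <=
    (1 + b / a) * x ord0 i ^+ 2 + (1 + a / b) * y ord0 i ^+ 2.
  rewrite mxE; set s := x _ _; set t := y _ _.
  rewrite -subr_ge0.
  rewrite (_ : _ - _ = (b * s - a * t) ^+ 2 / (a * b)); last by field; apply/andP.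
  by rewrite divr_ge0 ?sqr_ge0// mulr_ge0// ltW.
apply: (le_trans (ler_sum _ (fun i _ => amgm i))).
rewrite big_split/= -!mulr_sumr -!enorm_sqr -/a -/b.
by rewrite le_eqVlt; apply/orP; left; apply/eqP; field; apply/andP.
Qed.

Lemma enorm_triangle (n : nat) (x y z : 'rV[R]_n) :
  enorm (x - z) <= enorm (x - y) + enorm (y - z).
Proof. by rewrite -(subrKA y) enormD. Qed.

Lemma enorm_leD (n : nat) (x y : 'rV[R]_n) : enorm x <= enorm y + enorm (x - y).
Proof. by rewrite -{1}(subrK y x) addrC enormD. Qed.

End euclidean_norm.

(** * Continuity on a set and calculus by coordinates *)

Lemma within_continuousP {R : realType} {V : normedModType R} (A : set R) (u : R -> V) :
  {within A, continuous u} <->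
  forall t, A t -> forall e, 0 < e ->
    exists2 d, 0 < d & forall s, A s -> `|s - t| < d -> `|u s - u t| <= e.
Proof.
rewrite continuous_subspace_in; split=> cu.
  move=> t At e e0.
  have := cu t (mem_set At) => /cvgrPdist_le/(_ e e0).
  rewrite /prop_near1 /nbhs/= -nbhs_subspace_in// /within/= => -[d /= d0 du].
  exists d => // s As st; rewrite distrC; apply: du => //=.
  by rewrite distrC.
move=> t /set_mem At; apply/cvgrPdist_le => e e0.
have [d d0 du] := cu t At e e0.
rewrite /prop_near1 /nbhs/= -nbhs_subspace_in// /within/=.
exists d => //= s st As; rewrite distrC; apply: du => //.
by rewrite distrC.
Qed.

Section coordinates.
Context {R : realType} {n : nat}.
Implicit Types (phi : R -> 'rV[R]_n).

Lemma coord_le_norm (x : 'rV[R]_n) i : `|x ord0 i| <= `|x|.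
Proof.
rewrite [leRHS]/Num.Def.normr/= mx_normrE.
exact: (le_bigmax _ (fun j => `|x j.1 j.2|) (ord0, i)).
Qed.

Lemma is_derive_coordP phi (t : R) (v : 'rV[R]_n) :
  is_derive t 1 phi v <-> forall i, is_derive t 1 (fun s => phi s ord0 i) (v ord0 i).
Proof.
split=> [[dphi <-] i|dphi].
  apply: DeriveDef; first exact: (derivable_mxP phi t 1).1.
  by rewrite derive_mx// mxE.
have phi1 : derivable phi t 1.
  by apply/derivable_mxP => i j; rewrite ord1; have [] := dphi j.
apply: DeriveDef => //; rewrite derive_mx//.
by apply/rowP => i; rewrite mxE; have [] := dphi i.
Qed.

Lemma within_continuous_coordP (A : set R) phi :
  {within A, continuous phi} <-> forall i, {within A, continuous (fun s => phi s ord0 i)}.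
Proof.
split=> [cphi i|cphi].
  move=> x; apply: (@continuous_comp (subspace A) 'rV[R]_n R phi
    (fun M => M ord0 i) x (cphi x)).
  exact: coord_continuous.
move=> x; apply/cvgrPdist_le => /= e e0.
near=> y.
rewrite /Num.Def.normr/= mx_normrE (bigmax_le _ (ltW e0))//= => -[i j] _.
rewrite !mxE/= ord1.
move: j; near: y; apply: filter_forall => /= j.
by have /cvgrPdist_le := cphi j x; exact.
Unshelve. all: by end_near. Qed.

End coordinates.

(** * Mean value estimates and induction along a real interval *)

Section real_functions.
Context {R : realType}.
Implicit Types (u W du dW : R -> R) (a b : R).

(** By the mean value theorem [u + W] does not decrease and [u - W] does not increase. A dominating
    function rather than a constant bound leaves room for exponential weights. *)
Lemma ler_norm_derive u W du dW a b : a <= b ->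
  {within [set t | a <= t <= b], continuous u} ->
  {within [set t | a <= t <= b], continuous W} ->
  (forall t, a < t < b -> is_derive t 1 u (du t)) ->
  (forall t, a < t < b -> is_derive t 1 W (dW t)) ->
  (forall t, a < t < b -> `|du t| <= dW t) ->
  `|u b - u a| <= W b - W a.
Proof.
rewrite le_eqVlt => /predU1P[<-|ab]; first by rewrite !subrr normr0.
have -> : [set t | a <= t <= b] = [set` `[a, b]] by [].
move=> cu cW du_ dW_ le_duW.
have inab t : t \in `]a, b[ -> a < t < b by rewrite in_itv.
have ba : 0 <= b - a by rewrite subr_ge0 ltW.
rewrite ler_norml; apply/andP; split.
  have [t|x|c /inab cab] := @MVT R (fun t => u t + W t) (fun t => du t + dW t) a b ab.
  - by move=> /inab tab; apply: is_deriveD; [exact: du_|exact: dW_].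
  - by apply: continuousD; [exact: cu|exact: cW].
  move=> E.
  suff : 0 <= (du c + dW c) * (b - a) by lra.
  rewrite mulr_ge0//; have := le_duW _ cab; rewrite ler_norml; lra.
have [t|x|c /inab cab] := @MVT R (fun t => u t - W t) (fun t => du t - dW t) a b ab.
- by move=> /inab tab; apply: is_deriveB; [exact: du_|exact: dW_].
- by apply: continuousB; [exact: cu|exact: cW].
move=> E.
suff : 0 <= (dW c - du c) * (b - a) by lra.
rewrite mulr_ge0//; have := le_duW _ cab; rewrite ler_norml; lra.
Qed.

(** Let [c] be the supremum of the times up to which [P] holds: the first step condition carries [P]
    to [c] itself, the second would push it past [c] if [c < T]. *)
Lemma real_induction (P : R -> Prop) (T : R) : 0 <= T ->
  P 0 ->
  (forall t, 0 < t <= T -> (forall s, 0 <= s < t -> P s) -> P t) ->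
  (forall t, 0 <= t < T -> (forall s, 0 <= s <= t -> P s) ->
     exists2 d, 0 < d & forall s, t < s < t + d -> s <= T -> P s) ->
  forall t, 0 <= t <= T -> P t.
Proof.
move=> T0 P0 Pleft Pright.
pose S := [set t | 0 <= t <= T /\ forall s, 0 <= s <= t -> P s].
have S0 : S 0.
  by split; [rewrite lexx|move=> s /le_anti <-].
have supS : has_sup S by split; [exists 0|exists T => t [/andP[]]].
pose c := sup S.
have c0 : 0 <= c by exact: sup_upper_bound.
have cT : c <= T by apply: sup_le_ub; [exists 0|move=> t [/andP[]]].
have Pc s : 0 <= s < c -> P s.
  case/andP=> s0 sc; have [t [_ +] /ltW st] := sup_gt (ex_intro _ _ S0) sc.
  by apply; rewrite s0.
have Pcc s : 0 <= s <= c -> P s.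
  case/andP=> s0; rewrite le_eqVlt => /predU1P[->|sc]; last by apply: Pc; rewrite s0.
  move: c0; rewrite le_eqVlt => /predU1P[<-//|c_gt0].
  by apply: Pleft => //; rewrite c_gt0.
suff <- : c = T by [].
apply/eqP; rewrite eq_le cT/= leNgt; apply/negP => cltT.
have [|d d0 Pd] := Pright c _ Pcc; first by rewrite c0.
pose r := Num.min T (c + d / 2).
have cr : c < r by rewrite lt_min cltT/=; lra.
have rd : r < c + d by rewrite gt_min; apply/orP; right; lra.
have rT : r <= T by rewrite ge_min lexx.
suff /(sup_upper_bound supS) : S r by rewrite leNgt cr.
split=> [|s /andP[s0 sr]]; first by rewrite rT (le_trans c0)// ltW.
have [sc|cs] := leP s c; first by apply: Pcc; rewrite s0.
apply: Pd; last exact: le_trans rT.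
by rewrite cs (le_lt_trans sr).
Qed.

End real_functions.

(** * A Gronwall estimate by coordinates *)

Section gronwall.
Context {R : realType}.

Lemma is_derive_mull (c : R) (u : R -> R) (t du : R) :
  is_derive t 1 u du -> is_derive t 1 (fun s => c * u s) (c * du).
Proof. exact: is_deriveZ. Qed.

Lemma is_derive_expRM (A L t : R) :
  is_derive t 1 (fun s => A * expR (L * s)) (L * (A * expR (L * t))).
Proof.
have dL : is_derive t 1 (fun s : R => L * s) L.
  by have := is_derive_mull L (is_derive_id t 1); rewrite mulr1.
have := is_derive_mull A (is_derive1_comp (is_derive_expR (L * t)) dL).
by rewrite mulrA mulrC.
Qed.

Lemma within_continuous_derive (A : set R) (u du : R -> R) :
  (forall t, A t -> is_derive t 1 u (du t)) -> {within A, continuous u}.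
Proof.
move=> dA; rewrite continuous_subspace_in => t /set_mem At.
apply: continuous_subspaceT_for => //.
by apply: differentiable_continuous; apply/derivable1_diffP; have [] := dA t At.
Qed.

Variable n : nat.
Implicit Types d dd : R -> 'rV[R]_n.

(* The differential inequality is only required while [d] obeys the
   exponential bound: the estimate bootstraps itself. *)
Lemma gronwall_coord d dd (T A0 A L : R) : 0 <= T -> 0 <= L -> 0 <= A0 -> A0 < A ->
  {within [set t | 0 <= t <= T], continuous d} ->
  (forall t, 0 < t < T -> is_derive t 1 d (dd t)) ->
  (forall i, `|d 0 ord0 i| <= A0) ->
  (forall t, 0 < t < T -> (forall i, `|d t ord0 i| <= A * expR (L * t)) ->
     forall i, `|dd t ord0 i| <= L * (A * expR (L * t))) ->
  forall t, 0 <= t <= T -> forall i, `|d t ord0 i| <= A0 + A * (expR (L * t) - 1).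
Proof.
move=> T0 L0 A00 A0A cd dd_ d0 bnd.
have Ap : 0 < A := le_lt_trans A00 A0A.
have cdi := (within_continuous_coordP _ _).1 cd.
have key r : 0 <= r <= T ->
    (forall t, 0 < t < r -> forall i, `|d t ord0 i| <= A * expR (L * t)) ->
    forall i, `|d r ord0 i| <= A0 + A * (expR (L * r) - 1).
  move=> /andP[r0 rT] dA i.
  have : `|d r ord0 i - d 0 ord0 i| <= A * expR (L * r) - A * expR (L * 0).
    apply: (@ler_norm_derive R (fun t => d t ord0 i) (fun t => A * expR (L * t))
      (fun t => dd t ord0 i) (fun t => L * (A * expR (L * t))) 0 r r0).
    - apply: continuous_subspaceW (cdi i) => t /= /andP[-> tr].
      exact: le_trans rT.
    - by apply: within_continuous_derive => t _; exact: is_derive_expRM.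
    - move=> t /andP[t0 tr]; apply: (is_derive_coordP _ _ _).1.
      by apply: dd_; rewrite t0 (lt_le_trans tr).
    - by move=> t _; exact: is_derive_expRM.
    - move=> t /andP[t0 tr]; apply: bnd; first by rewrite t0 (lt_le_trans tr).
      by apply: dA; rewrite t0.
  rewrite mulr0 expR0 mulr1 => drA; have := d0 i.
  have := ler_normD (d r ord0 i - d 0 ord0 i) (d 0 ord0 i); rewrite subrK.
  lra.
(* The derived bound undercuts the assumed one by the constant [A - A0]. This margin lets continuity
   carry the assumption a little beyond [t]. *)
have weak t i : `|d t ord0 i| <= A0 + A * (expR (L * t) - 1) ->
    `|d t ord0 i| <= A * expR (L * t) - (A - A0).
  by move=> /le_trans; apply; lra.
apply: real_induction => //.
- by move=> i; rewrite mulr0 expR0 subrr mulr0 addr0.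
- move=> t /andP[t0 tT] Pt; apply: key => [|s /andP[s0 st] i]; first by rewrite ltW.
  by have := weak _ _ (Pt s _ i); rewrite ltW// st => /(_ isT); lra.
- move=> t /andP[t0 tT] Pt.
  have tT' : [set s | 0 <= s <= T] t by rewrite /= t0 ltW.
  have e0 : 0 < A - A0 by rewrite subr_gt0.
  have [del del0 ddel] := (within_continuousP _ d).1 cd t tT' _ e0.
  exists del => // s /andP[ts std] sT.
  have s0 : 0 <= s by rewrite (le_trans t0)// ltW.
  apply: key => [|r /andP[r0 rs] i]; first by rewrite s0.
  have [rt|tr] := leP r t.
    by have := weak _ _ (Pt r _ i); rewrite (ltW r0) rt => /(_ isT); lra.
  have : `|d r - d t| <= A - A0.
    apply: ddel; first by rewrite /= (ltW r0) (le_trans (ltW rs)).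
    by rewrite ger0_norm ?subr_ge0 ?ltW//; lra.
  move=> /(le_trans (coord_le_norm _ i)); rewrite !mxE => drt.
  have := weak _ _ (Pt t _ i); rewrite t0 lexx => /(_ isT).
  have : A * expR (L * t) <= A * expR (L * r).
    by rewrite ler_pM2l// ler_expR ler_wpM2l// ltW.
  have := ler_normD (d r ord0 i - d t ord0 i) (d t ord0 i); rewrite subrK.
  lra.
Qed.

End gronwall.

(** * Antiderivatives of continuous functions *)

Section antiderivative.
Context {R : realType}.
Notation mu := (@lebesgue_measure R).

(** The integral from 0 to [t], based at -1 so that 0 is an interior point, where the fundamental
    theorem still gives a two-sided derivative. *)
Definition antideriv (F : R -> R) (t : R) : R :=
  (\int[mu]_(s in `[-1, t]) F s - \int[mu]_(s in `[-1, 0]) F s)%R.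

Lemma antideriv0 F : antideriv F 0 = 0.
Proof. exact: subrr. Qed.

Lemma is_derive_antideriv (F : R -> R) (t : R) : continuous F -> -1 < t ->
  is_derive t 1 (antideriv F) (F t).
Proof.
move=> cF t1.
have intF : mu.-integrable `[-1, t + 1] (EFin \o F).
  apply: continuous_compact_integrable; first exact: segment_compact.
  exact: continuous_subspaceT.
have [|dF dFE] := continuous_FTC1_closed _ intF t1 (cF t); first by rewrite ltrDl.
have -> : F t = F t - 0 by rewrite subr0.
apply: is_deriveB; apply: DeriveDef => //.
by rewrite -derive1E.
Qed.

End antiderivative.

(** * Projection onto an interval, used both for time and for coordinates *)

Section clamp.
Context {R : realType}.

Definition clamp (a b x : R) : R := Num.max a (Num.min b x).

Lemma clamp_id (a b x : R) : a <= x <= b -> clamp a b x = x.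
Proof. by move=> /andP[ax xb]; rewrite /clamp min_r// max_r. Qed.

Lemma clamp_itv (a b x : R) : a <= b -> a <= clamp a b x <= b.
Proof. by move=> ab; rewrite le_max lexx ge_max ab ge_min lexx. Qed.

Lemma clamp_lip (a b x y : R) : a <= b -> `|clamp a b x - clamp a b y| <= `|x - y|.
Proof.
move=> ab; have := ler_norm (x - y); have := ler_norm (y - x).
rewrite (distrC y x) ler_norml /clamp /Order.max /Order.min.
by case: (ltP b x) => ?; case: (ltP b y) => ?; do 2?case: ltP => ?; lra.
Qed.

End clamp.

(** * Picard iteration for a globally Lipschitz field *)

Section picard.
Context {R : realType}.

Lemma le_geometric_limit (x c : R) : (forall k : nat, x <= c / 2 ^+ k) -> x <= 0.
Proof.
move=> xc; rewrite leNgt; apply/negP => x0.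
have c0 : 0 < c by have := lt_le_trans x0 (xc 0%N); rewrite expr0 divr1.
have [k ck] : exists k : nat, c / x < k%:R.
  by exists (Num.truncn (c / x)).+1; exact: truncnS_gt.
have := xc k; rewrite leNgt => /negP; apply.
rewrite ltr_pdivrMr ?exprn_gt0// -ltr_pdivrMl// mulrC (lt_le_trans ck)//.
by rewrite -natrX ler_nat ltnW// ltn_expl.
Qed.

(** The intervals of centre [u k] and radius [2 * D / 2 ^+ k] are nested, and the supremum of their
    left ends lies in all of them. *)
Lemma geometric_cauchy_limit (u : nat -> R) (D : R) :
  (forall k, `|u k.+1 - u k| <= D / 2 ^+ k) ->
  exists l, forall k, `|u k - l| <= 2 * D / 2 ^+ k.
Proof.
move=> uD.
have D0 : 0 <= D by have := le_trans (normr_ge0 _) (uD 0%N); rewrite expr0 divr1.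
pose r k := 2 * D / 2 ^+ k.
have r0 k : 0 <= r k by rewrite /r divr_ge0 ?mulr_ge0 ?exprn_ge0.
have rS k : r k - D / 2 ^+ k = r k.+1.
  by rewrite /r exprS; field; rewrite expf_neq0.
have up : {homo (fun k => u k - r k) : i j / (i <= j)%N >-> i <= j}.
  apply: homo_leq; [exact: lexx|exact: le_trans|move=> k].
  by have := uD k; have := rS k; rewrite ler_norml; lra.
have dn : {homo (fun k => u k + r k) : i j / (i <= j)%N >-> j <= i}.
  apply: homo_leq; [exact: lexx|by move=> x y z yx /le_trans; apply|move=> k].
  by have := uD k; have := rS k; rewrite ler_norml; lra.
have updn i j : u i - r i <= u j + r j.
  have := up _ _ (leq_maxl i j); have := dn _ _ (leq_maxr i j).
  have := r0 (maxn i j); move=> /=; lra.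
pose S := range (fun k => u k - r k).
have supS : has_sup S.
  split; first by exists (u 0%N - r 0%N); exists 0%N.
  by exists (u 0%N + r 0%N) => _ [i _ <-].
exists (sup S) => k; rewrite -/(r k) ler_norml.
have : u k - r k <= sup S by apply: sup_upper_bound => //; exists k.
have : sup S <= u k + r k by apply: sup_le_ub; [exact: supS.1|move=> _ [i _ <-]].
lra.
Qed.

Variables (n : nat) (g : 'rV[R]_n -> 'rV[R]_n) (L T : R) (x0 : 'rV[R]_n).
Hypotheses (L0 : 0 < L) (T0 : 0 <= T).
Hypothesis glip : forall (x y : 'rV[R]_n) (c : R), (forall i, `|x ord0 i - y ord0 i| <= c) ->
  forall i, `|g x ord0 i - g y ord0 i| <= L * c.

(** Clamping the time freezes the iterates outside the interval from 0 to [T]. They are then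
    continuous on the whole line, as [is_derive_antideriv] demands of its integrand. *)
Definition picard_step (psi : R -> 'rV[R]_n) (t : R) : 'rV[R]_n :=
  \row_i (x0 ord0 i + antideriv (fun s => g (psi s) ord0 i) (clamp 0 T t)).

Definition row_continuous (psi : R -> 'rV[R]_n) :=
  forall t e, 0 < e -> exists2 del, 0 < del & forall s, `|s - t| < del ->
    forall i, `|psi s ord0 i - psi t ord0 i| <= e.

Lemma row_continuous_coord psi i : row_continuous psi -> continuous (fun s => psi s ord0 i).
Proof.
move=> cpsi t; apply/cvgrPdist_le => /= e e0.
have [del del0 dpsi] := cpsi t e e0; exists del => // s /= st.
by rewrite distrC; apply: dpsi; rewrite distrC.
Qed.

Lemma row_continuous_field psi : row_continuous psi -> row_continuous (g \o psi).
Proof.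
move=> cpsi t e e0; have [|del del0 dpsi] := cpsi t (e / L); first exact: divr_gt0.
exists del => // s /dpsi /glip st i; rewrite (le_trans (st i))//.
by rewrite mulrC divfK// gt_eqF.
Qed.

Lemma picard_step0 psi : picard_step psi 0 = x0.
Proof.
apply/rowP => i; rewrite mxE clamp_id ?lexx//.
by rewrite antideriv0 addr0.
Qed.

Lemma is_derive_picard_step psi t i : row_continuous psi -> 0 < t < T ->
  is_derive t 1 (fun s => picard_step psi s ord0 i) (g (psi t) ord0 i).
Proof.
move=> /row_continuous_field/row_continuous_coord cg /andP[t0 tT].
have t1 : -1 < t by rewrite (lt_trans _ t0)// ltrN10.
have := is_deriveD (is_derive_cst (x0 ord0 i) t 1) (is_derive_antideriv (cg i) t1).
rewrite add0r; apply: near_eq_is_derive.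
near=> s; rewrite mxE clamp_id//.
have : s \in `]0, T[ by near: s; apply: near_in_itvoo; rewrite in_itv/= t0.
by rewrite in_itv/= => /andP[/ltW -> /ltW].
Unshelve. all: by end_near. Qed.

Lemma row_continuous_picard_step psi : row_continuous psi -> row_continuous (picard_step psi).
Proof.
move=> cpsi t e e0.
have cg i : continuous (fun s => g (psi s) ord0 i) :=
  row_continuous_coord (row_continuous_field cpsi).
have [del del0 ddel] : exists2 del, 0 < del & forall s, `|s - t| < del -> forall i,
    `|antideriv (fun s => g (psi s) ord0 i) (clamp 0 T s) -
      antideriv (fun s => g (psi s) ord0 i) (clamp 0 T t)| <= e.
  have : \forall s \near (t : R), forall i,
     `|antideriv (fun s => g (psi s) ord0 i) (clamp 0 T s) -
      antideriv (fun s => g (psi s) ord0 i) (clamp 0 T t)| <= e.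
    near=> s; near: s; apply: filter_forall => /= i.
    have t1 : -1 < clamp 0 T t.
      by have /andP[+ _] := clamp_itv t T0; apply: lt_le_trans; exact: ltrN10.
    have [dA _] := is_derive_antideriv (cg i) t1.
    have /cvgrPdist_le/(_ e e0)[del /= del0 ddel] :=
      differentiable_continuous ((derivable1_diffP _ _).1 dA).
    exists del => // s /= st; rewrite distrC; apply: ddel => /=.
    by rewrite (le_lt_trans (clamp_lip _ _ T0)).
  by move=> [del del0 ddel]; exists del => // s st; apply: ddel; rewrite /= distrC.
exists del => // s /ddel st i; rewrite !mxE.
by rewrite opprD addrACA subrr add0r.
Unshelve. all: by end_near. Qed.

Fixpoint picard_iter (k : nat) : R -> 'rV[R]_n :=
  if k is k'.+1 then picard_step (picard_iter k') else fun=> x0.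

Lemma row_continuous_picard_iter k : row_continuous (picard_iter k).
Proof.
elim: k => [|k IH]; last exact: row_continuous_picard_step.
by move=> t e e0; exists 1 => // s _ i; rewrite subrr normr0 ltW.
Qed.

Lemma picard_iter_clamp k t : picard_iter k t = picard_iter k (clamp 0 T t).
Proof.
case: k => // k; apply/rowP => i; rewrite !mxE [clamp _ _ (clamp _ _ _)]clamp_id//.
exact: clamp_itv.
Qed.

(** The weight [W] is left free: an exponential one makes the step a contraction, a linear one
    serves to identify the limit. *)
Lemma picard_step_dist psi1 psi2 (W dW : R -> R) : row_continuous psi1 -> row_continuous psi2 ->
  (forall t : R, is_derive t 1 W (dW t)) ->
  (forall t, 0 <= t <= T -> forall i, `|psi1 t ord0 i - psi2 t ord0 i| <= dW t / L) ->
  forall t, 0 <= t <= T -> forall i,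
    `|picard_step psi1 t ord0 i - picard_step psi2 t ord0 i| <= W t - W 0.
Proof.
move=> c1 c2 dW_ psiW t /andP[t0 tT] i.
have := @ler_norm_derive R
  (fun t => picard_step psi1 t ord0 i - picard_step psi2 t ord0 i) W
  (fun t => g (psi1 t) ord0 i - g (psi2 t) ord0 i) dW 0 t t0.
rewrite /= !picard_step0 subrr subr0; apply.
- apply: continuous_subspaceT => s.
  by apply: continuousB; apply: row_continuous_coord; exact: row_continuous_picard_step.
- by apply: (@within_continuous_derive _ _ _ dW) => s _; exact: dW_.
- move=> s /andP[s0 st]; apply: is_deriveB; apply: is_derive_picard_step => //;
    by rewrite s0 (lt_le_trans st).
- move=> s /andP[s0 st].
  rewrite -[leRHS](@divfK _ L) ?gt_eqF// mulrC; apply: glip => j.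
  by apply: psiW; rewrite (ltW s0) (le_trans (ltW st)).
Qed.

(** Relative to the weight [expR (2 * L * t)] one step halves distances, however long the interval
    is. Its value at [T] gives a bound for all [t], since the iterates depend on the clamped time
    only. *)
Lemma picard_iter_cauchy : exists D, forall k t i,
  `|picard_iter k.+1 t ord0 i - picard_iter k t ord0 i| <= D / 2 ^+ k.
Proof.
(* Chosen so that the derivative of [N * expR (2 * L * t)] is at least [enorm (g x0)], which starts
   the induction. *)
pose N := enorm (g x0) / (2 * L).
have N0 : 0 <= N by rewrite divr_ge0 ?enorm_ge0 ?mulr_ge0// ltW.
have step k t : 0 <= t <= T -> forall i,
    `|picard_iter k.+1 t ord0 i - picard_iter k t ord0 i| <=
    N / 2 ^+ k * expR (2 * L * t).
  elim: k t => [|k IH] t /andP[t0 tT] i.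
    have := @ler_norm_derive R (fun t => picard_iter 1 t ord0 i)
      (fun t => N * expR (2 * L * t)) (fun t => g x0 ord0 i)
      (fun t => 2 * L * (N * expR (2 * L * t))) 0 t t0.
    rewrite /= picard_step0 expr0 divr1 => H.
    apply: le_trans (H _ _ _ _ _) _.
    - apply: continuous_subspaceT => s; apply: row_continuous_coord.
      exact: (row_continuous_picard_iter 1).
    - by apply: within_continuous_derive => s _; exact: is_derive_expRM.
    - move=> s /andP[s0 st]; apply: is_derive_picard_step.
        exact: (row_continuous_picard_iter 0).
      by rewrite s0 (lt_le_trans st).
    - by move=> s _; exact: is_derive_expRM.
    - move=> s /andP[s0 st]; rewrite mulrA (_ : 2 * L * N = enorm (g x0)); last first.
        by rewrite /N; field; rewrite gt_eqF.
      apply: le_trans (coord_le_enorm _ _) _.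
      by rewrite ler_peMr ?enorm_ge0// -expR0 ler_expR !mulr_ge0// ltW.
    - by rewrite gerBl mulr_ge0 ?expR_ge0.
  apply: le_trans (@picard_step_dist _ _ (fun t => N / 2 ^+ k.+1 * expR (2 * L * t))
    (fun t => 2 * L * (N / 2 ^+ k.+1 * expR (2 * L * t)))
    (row_continuous_picard_iter k.+1) (row_continuous_picard_iter k) _ _ t _ i) _.
  - by move=> s; exact: is_derive_expRM.
  - move=> s sT j; apply: le_trans (IH s sT j) _.
    rewrite le_eqVlt; apply/orP; left; apply/eqP; rewrite exprS.
    by field; rewrite expf_neq0//= gt_eqF.
  - by rewrite t0.
  - by rewrite gerBl mulr_ge0 ?expR_ge0// divr_ge0// exprn_ge0.
exists (N * expR (2 * L * T)) => k t i.
rewrite !(picard_iter_clamp _ t); have ct := clamp_itv t T0.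
apply: le_trans (step k _ ct i) _; rewrite mulrAC ler_wpM2r ?invr_ge0 ?exprn_ge0//.
by rewrite ler_wpM2l// ler_expR ler_wpM2l ?mulr_ge0 ?(ltW L0)//; case/andP: ct.
Qed.

(** The iterates converge at a geometric rate uniform in time, so the limit [psi] is continuous, and
    letting [k] grow shows that it is a fixed point of the step on the interval. *)
Lemma picard_lindelof : exists phi, is_sol g x0 T phi.
Proof.
have [D stepD] := picard_iter_cauchy.
have D0 k : 0 <= 2 * `|D| / 2 ^+ k by rewrite divr_ge0 ?mulr_ge0 ?exprn_ge0.
have /choice[psi0 psi0P] : forall t, exists v : 'I_n -> R, forall i k,
    `|picard_iter k t ord0 i - v i| <= 2 * `|D| / 2 ^+ k.
  move=> t; suff /choice[v vP] : forall i, exists l, forall k,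
      `|picard_iter k t ord0 i - l| <= 2 * `|D| / 2 ^+ k by exists v.
  move=> i; apply: geometric_cauchy_limit => k.
  apply: le_trans (stepD k t i) _.
  by rewrite ler_wpM2r ?invr_ge0 ?exprn_ge0// ler_norm.
pose psi t : 'rV[R]_n := \row_i psi0 t i.
have psiP t k i : `|picard_iter k t ord0 i - psi t ord0 i| <= 2 * `|D| / 2 ^+ k.
  by rewrite mxE.
have cpsi : row_continuous psi.
  move=> t e e0.
  have [k kD] : exists k : nat, 2 * `|D| / 2 ^+ k <= e / 3.
    apply/not_existsP => H; have e30 : 0 < e / 3 by rewrite divr_gt0.
    have : e / 3 <= 0.
      by apply: (@le_geometric_limit _ (2 * `|D|)) => k; have /negP := H k; rewrite -ltNge => /ltW.
    by rewrite leNgt e30.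
  have [|del del0 ddel] := row_continuous_picard_iter k t (e := e / 3); first by rewrite divr_gt0.
  exists del => // s /ddel st i; have := st i; have := psiP t k i; have := psiP s k i.
  rewrite !ler_norml; lra.
have cPhi := row_continuous_picard_step cpsi.
have fixpsi t : 0 <= t <= T -> picard_step psi t = psi t.
  move=> tT; apply/rowP => i; apply/eqP; rewrite -subr_eq0 -normr_le0.
  apply: (@le_geometric_limit _ (2 * `|D| + L * (2 * `|D|) * T)) => k.
  have dist : `|picard_step psi t ord0 i - picard_iter k.+1 t ord0 i| <=
      L * (2 * `|D|) * T / 2 ^+ k.
    apply: le_trans (@picard_step_dist _ _ (fun t => (L * (2 * `|D| / 2 ^+ k)) * t)
      (fun t => L * (2 * `|D| / 2 ^+ k)) cpsi (row_continuous_picard_iter k) _ _ t tT i) _.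
    - move=> s; set c := L * _.
      by have := is_derive_mull c (is_derive_id s 1); rewrite mulr1.
    - by move=> s _ j; rewrite mulrC mulKf ?gt_eqF// distrC.
    - rewrite mulr0 subr0 !mulrA [in leRHS]mulrAC ler_wpM2l//.
        by rewrite mulr_ge0 ?invr_ge0 ?exprn_ge0// !mulr_ge0// ltW.
      by case/andP: tT.
  have := psiP t k.+1 i.
  have : 2 * `|D| / 2 ^+ k.+1 <= 2 * `|D| / 2 ^+ k.
    rewrite ler_wpM2l ?mulr_ge0// lef_pV2 ?posrE ?exprn_gt0//.
    by rewrite ler_eXn2l// ltr1n.
  have := ler_normD (picard_step psi t ord0 i - picard_iter k.+1 t ord0 i)
    (picard_iter k.+1 t ord0 i - psi t ord0 i).
  rewrite subrKA mulrDl; lra.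
(* [picard_step psi] is taken instead of [psi]: it starts at [x0] and has the right derivative by
   construction, and both agree on the interval. *)
exists (picard_step psi); split; first exact: picard_step0.
split.
  apply/within_continuous_coordP => i; apply: continuous_subspaceT => s.
  exact: row_continuous_coord.
move=> t tT; apply/is_derive_coordP => i; rewrite fixpsi; last first.
  by case/andP: tT => /ltW -> /ltW.
exact: is_derive_picard_step.
Qed.

End picard.

(** * Existence of solutions for locally Lipschitz fields *)

Section existence.
Context {R : realType}.

Definition clamp_row n (c : R) (x : 'rV[R]_n) : 'rV[R]_n :=
  \row_i clamp (- c) c (x ord0 i).

Lemma clamp_row_id n c (x : 'rV[R]_n) :
  (forall i, `|x ord0 i| <= c) -> clamp_row c x = x.
Proof. by move=> xc; apply/rowP => i; rewrite mxE clamp_id// -ler_norml. Qed.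

Lemma enorm_clamp_row n c (x : 'rV[R]_n) : 0 <= c ->
  enorm (clamp_row c x) <= n.+1%:R * c.
Proof.
move=> c0; apply: enorm_le_coord => // i.
by rewrite mxE ler_norml clamp_itv// -subr_ge0 opprK addr_ge0.
Qed.

Definition locally_lipschitz n (h : 'rV[R]_n -> 'rV[R]_n) :=
  forall M, 0 <= M -> exists L, 0 < L /\ forall x y, enorm x <= M -> enorm y <= M ->
    enorm (h x - h y) <= L * enorm (x - y).

(** Clamped states lie in a fixed ball, where one Lipschitz constant is valid; passing from the
    Euclidean norm to coordinates costs the factor [n.+1]. *)
Lemma clamped_existence n (h : 'rV[R]_n -> 'rV[R]_n) c T x0 : 0 <= c -> 0 <= T ->
  locally_lipschitz h -> exists phi, is_sol (fun z => h (clamp_row c z)) x0 T phi.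
Proof.
move=> c0 T0 lip; have [|L [L0 hL]] := lip (n.+1%:R * c); first exact: mulr_ge0.
apply: (@picard_lindelof _ _ _ (L * n.+1%:R)); [exact: mulr_gt0|exact: T0|].
move=> x y e xye i; have e0 : 0 <= e by exact: le_trans (xye i).
have := coord_le_enorm (h (clamp_row c x) - h (clamp_row c y)) i.
rewrite !mxE => /le_trans; apply.
apply: le_trans (hL _ _ (enorm_clamp_row _ c0) (enorm_clamp_row _ c0)) _.
rewrite -mulrA ler_wpM2l ?(ltW L0)//; apply: enorm_le_coord => // j.
rewrite !mxE; apply: le_trans (xye j); apply: clamp_lip.
by rewrite -subr_ge0 opprK addr_ge0.
Qed.

Lemma is_sol_clamp n (h : 'rV[R]_n -> 'rV[R]_n) c T x0 phi (r : R) : r <= T ->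
  is_sol (fun z => h (clamp_row c z)) x0 T phi ->
  (forall t, 0 < t < r -> forall i, `|phi t ord0 i| <= c) ->
  is_sol h x0 r phi.
Proof.
move=> rT [phi0 [cphi dphi]] phic; split=> //; split.
  by apply: continuous_subspaceW cphi => t /= /andP[-> /le_trans]; apply.
move=> t /andP[t0 tr]; rewrite -(@clamp_row_id _ c (phi t)).
  by apply: dphi; rewrite t0 (lt_le_trans tr).
by apply: phic; rewrite t0.
Qed.

(** Clamp at [B + 1]. While the coordinates stay below [B + 1] the clamp is invisible, so the a
    priori bound applies and gives [B]; the margin 1 lets continuity carry this on up to [T]. *)
Lemma apriori_existence n (h : 'rV[R]_n -> 'rV[R]_n) (B : R) x0 :
  locally_lipschitz h ->
  (forall T phi, 0 <= T -> is_sol h x0 T phi ->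
    forall t, 0 <= t <= T -> enorm (phi t) <= B) ->
  forall T, 0 <= T -> exists phi, is_sol h x0 T phi.
Proof.
move=> lip bnd T T0.
(* From the constant solution on the degenerate interval of length 0. *)
have B0 : 0 <= B.
  have := bnd 0 (fun=> x0) (lexx 0) _ 0; rewrite lexx => H.
  apply: le_trans (H _ isT); first exact: enorm_ge0.
  split=> //; split; first exact: continuous_subspaceT (@cst_continuous _ _ x0).
  by move=> t /andP[/lt_trans/[apply]]; rewrite ltxx.
have [|phi phiP] := clamped_existence (c := B + 1) x0 _ T0 lip.
  by rewrite addr_ge0.
have [phi0 [cphi _]] := phiP.
have key r : 0 <= r <= T ->
    (forall t, 0 < t < r -> forall i, `|phi t ord0 i| <= B + 1) -> enorm (phi r) <= B.
  move=> /andP[r0 rT] phiB; apply: (bnd r phi r0); last by rewrite r0 lexx.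
  exact: is_sol_clamp phiP phiB.
have coordB t i : enorm (phi t) <= B -> `|phi t ord0 i| <= B + 1.
  by move=> phiB; apply: le_trans (coord_le_enorm _ _) _; rewrite ler_wpDr.
have phiB : forall t, 0 <= t <= T -> enorm (phi t) <= B.
  apply: real_induction => //.
  - apply: key => [|t /andP[/lt_trans/[apply]]]; rewrite ?ltxx//.
    by rewrite lexx.
  - move=> t /andP[t0 tT] Pt; apply: key => [|s /andP[s0 st] i]; first by rewrite ltW.
    by apply: coordB; apply: Pt; rewrite ltW.
  - move=> t /andP[t0 tT] Pt.
    have tT' : [set s | 0 <= s <= T] t by rewrite /= t0 ltW.
    have [del del0 dphi] := (within_continuousP _ phi).1 cphi t tT' _ ltr01.
    exists del => // s /andP[ts std] sT.
    have s0 : 0 <= s by rewrite (le_trans t0)// ltW.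
    apply: key => [|r /andP[r0 rs] i]; first by rewrite s0.
    have [rt|tr] := leP r t; first by apply: coordB; apply: Pt; rewrite ltW.
    have : `|phi r - phi t| <= 1.
      apply: dphi; first by rewrite /= (ltW r0) (le_trans (ltW rs)).
      by rewrite ger0_norm ?subr_ge0 ?ltW//; lra.
    move=> /(le_trans (coord_le_norm _ i)); rewrite !mxE => drt.
    have /(le_trans (coord_le_enorm _ i)) : enorm (phi t) <= B.
      by apply: Pt; rewrite t0 lexx.
    have := ler_normD (phi r ord0 i - phi t ord0 i) (phi t ord0 i); rewrite subrK.
    lra.
exists phi; apply: is_sol_clamp (lexx T) phiP _ => t /andP[t0 tT] i.
by apply: coordB; apply: phiB; rewrite !ltW.
Qed.

Variables (n m : nat) (f : 'rV[R]_n -> 'rV[R]_m -> 'rV[R]_n).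
Hypothesis fP : assumption1 f.

Lemma assumption1_lipschitz u : locally_lipschitz (fun z => f z u).
Proof.
move=> M M0; have [L [L0 fL]] := fP.2 M _ M0 (enorm_ge0 u).
exists L; split=> // x y xM yM.
by have := fL x y u u xM yM (lexx _) (lexx _); rewrite subrr enorm0 addr0.
Qed.

Lemma closed_loop_lipschitz uc : assumption2 uc ->
  locally_lipschitz (fun x => f x (uc x)).
Proof.
move=> [uc0 ucP] M M0; have [Lu [Lu0 ucL]] := ucP M M0.
have [|L [L0 fL]] := fP.2 M (Lu * M) M0; first by rewrite mulr_ge0// ltW.
have ucM x : enorm x <= M -> enorm (uc x) <= Lu * M.
  move=> xM; have := ucL x 0 xM; rewrite enorm0 uc0 !subr0 => /(_ M0)/le_trans; apply.
  by rewrite ler_wpM2l// ltW.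
exists (L * (1 + Lu)); split; first by rewrite mulr_gt0// addr_gt0.
move=> x y xM yM; apply: le_trans (fL _ _ _ _ xM yM (ucM _ xM) (ucM _ yM)) _.
by rewrite -mulrA ler_wpM2l ?(ltW L0)// mulrDl mul1r lerD2l ucL.
Qed.

(** The clamped field has speed at most [C], so before time [C^-1] no coordinate moves by more than
    1 and the clamp at [M + 1] is not felt. The time is uniform over the two balls. *)
Lemma local_existence (M Mu : R) : 0 <= M -> 0 <= Mu ->
  exists2 del, 0 < del & forall x u T, enorm x <= M -> enorm u <= Mu ->
    0 <= T < del -> exists phi, is_sol (fun z => f z u) x T phi.
Proof.
move=> M0 Mu0; pose c := M + 1; have c0 : 0 <= c by rewrite addr_ge0.
have cN : 0 < n.+1%:R * c by rewrite mulr_gt0// ltr_wpDl.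
have [L [L0 fL]] := fP.2 _ Mu (ltW cN) Mu0.
pose C := L * (n.+1%:R * c + Mu).
have C0 : 0 < C by rewrite mulr_gt0// ltr_wpDr.
exists C^-1; first by rewrite invr_gt0.
move=> x u T xM uMu /andP[T0 TC].
have [phi phiP] := clamped_existence x c0 T0 (assumption1_lipschitz u).
have [phi0 [cphi dphi]] := phiP.
exists phi; apply: is_sol_clamp (lexx T) phiP _ => t /andP[t0 tT] i.
have : `|phi t ord0 i - phi 0 ord0 i| <= C * t - C * 0.
  apply: (@ler_norm_derive R (fun s => phi s ord0 i) (fun s => C * s)
    (fun s => f (clamp_row c (phi s)) u ord0 i) (fun=> C)) => //.
  - exact: ltW.
  - apply: continuous_subspaceW ((within_continuous_coordP _ _).1 cphi i).
    by move=> s /= /andP[-> /le_trans]; apply; exact: ltW.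
  - apply: (@within_continuous_derive _ _ _ (fun=> C)) => s _.
    by have := is_derive_mull C (is_derive_id s 1); rewrite mulr1.
  - move=> s /andP[s0 st]; apply: (is_derive_coordP _ _ _).1.
    by apply: dphi; rewrite s0 (lt_trans st).
  - by move=> s _; have := is_derive_mull C (is_derive_id s 1); rewrite mulr1.
  - move=> s _; apply: le_trans (coord_le_enorm _ _) _.
    have := fL (clamp_row c (phi s)) 0 u 0 (enorm_clamp_row _ c0).
    rewrite fP.1 !subr0 !enorm0 => /(_ (ltW cN) uMu Mu0)/le_trans; apply.
    by rewrite ler_wpM2l ?(ltW L0)// lerD// enorm_clamp_row.
have : C * t <= 1.
  by rewrite mulrC -ler_pdivlMr// div1r (le_trans (ltW tT))// ltW.
have /(le_trans (coord_le_enorm _ i)) := xM.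
rewrite phi0 mulr0 subr0 /c.
have := ler_normD (phi t ord0 i - x ord0 i) (x ord0 i); rewrite subrK.
lra.
Qed.

End existence.

(** * Translation in time *)

Section shift.
Context {R : realType} {n : nat}.

Lemma within_continuous_shift (phi : R -> 'rV[R]_n) (a tau T : R) : 0 <= a -> a + tau <= T ->
  {within [set t | 0 <= t <= T], continuous phi} ->
  {within [set t | 0 <= t <= tau], continuous (fun t => phi (a + t))}.
Proof.
move=> a0 aT /within_continuousP cphi; apply/within_continuousP => t /andP[t0 ttau] e e0.
have inT s : 0 <= s <= tau -> [set t | 0 <= t <= T] (a + s).
  by move=> /andP[s0 stau] /=; rewrite addr_ge0//= (le_trans _ aT)// lerD2l.
have [|del del0 dphi] := cphi (a + t) _ e e0; first by apply: inT; rewrite t0.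
exists del => // s /inT saT st; apply: dphi => //.
by rewrite opprD addrACA subrr add0r.
Qed.

Lemma is_derive_shift_row (phi : R -> 'rV[R]_n) (a t : R) (v : 'rV[R]_n) :
  is_derive (a + t) 1 phi v -> is_derive t 1 (fun s => phi (a + s)) v.
Proof.
move=> /is_derive_coordP dphi; apply/is_derive_coordP => i.
have da : is_derive t 1 (fun s : R => a + s) 1.
  by have := is_deriveD (is_derive_cst a t 1) (is_derive_id t 1); rewrite add0r.
by have := is_derive1_comp (dphi i) da; rewrite mulr1.
Qed.

End shift.

(** Excludes the default of [xget] and provides a trajectory ending at the selected value, to which
    estimates on solutions apply. *)
Lemma FeP (R : realType) (n m : nat) (f : 'rV[R]_n -> 'rV[R]_m -> 'rV[R]_n) x u T :
  (exists phi, is_sol (fun z => f z u) x T phi) ->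
  exists2 psi, is_sol (fun z => f z u) x T psi & psi T = Fe f x u T.
Proof.
move=> [phi phiP]; rewrite /Fe; case: xgetP => [y _ [psi [psiP psiT]]|none].
  by exists psi.
by exfalso; apply: (none (phi T)); exists phi.
Qed.

(** * Error growth over one sampling step *)

Section one_step.
Context {R : realType} {n m : nat}.
Variables (f : 'rV[R]_n -> 'rV[R]_m -> 'rV[R]_n) (uc : 'rV[R]_n -> 'rV[R]_m).
Variables (M Mu L Lu N : R).
Hypotheses (N0 : 0 <= N) (L0 : 0 < L) (Lu0 : 0 < Lu) (f00 : f 0 0 = 0) (uc0 : uc 0 = 0).
Hypothesis fL : forall x y u v, enorm x <= M -> enorm y <= M ->
  enorm u <= Mu -> enorm v <= Mu ->
  enorm (f x u - f y v) <= L * (enorm (x - y) + enorm (u - v)).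
Hypothesis ucL : forall x y, enorm x <= M -> enorm y <= M ->
  enorm (uc x - uc y) <= Lu * enorm (x - y).
Hypothesis enorm_coord : forall (x : 'rV[R]_n) c, 0 <= c ->
  (forall i, `|x ord0 i| <= c) -> enorm x <= N * c.
Hypothesis ucM : forall x, enorm x <= M -> enorm (uc x) <= Mu.

(** The factor [2 + Lu] counts the current error in the state, in the sampled control and in the
    feedback; the final 1 absorbs the terms proportional to [b]. *)
Definition growth_rate : R := L * N * (2 + Lu) + 1.
Local Notation Lam := growth_rate.

Lemma growth_rate_ge0 : 0 <= Lam.
Proof. by rewrite /Lam addr_ge0// !mulr_ge0 ?addr_ge0// ltW. Qed.

Variables (phi : R -> 'rV[R]_n) (x0 : 'rV[R]_n) (T b : R).
Hypothesis b0 : 0 <= b.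
Hypothesis bM : b + N <= M.
Hypothesis phiP : is_sol (fun x => f x (uc x)) x0 T phi.
Hypothesis phib : forall t, 0 <= t <= T -> enorm (phi t) <= b.

Let M0 : 0 <= M.
Proof. by apply: le_trans bM; rewrite addr_ge0. Qed.

(** The field vanishes at 0, so along a solution of norm at most [b] its speed is at most
    [L * (1 + Lu) * b], which keeps the estimate proportional to [b]. *)
Lemma sol_variation (a t : R) : 0 <= a -> 0 <= t -> a + t <= T ->
  enorm (phi a - phi (a + t)) <= N * (L * (1 + Lu) * b * t).
Proof.
move=> a0 t0 atT; set C := L * (1 + Lu) * b.
have C0 : 0 <= C by rewrite !mulr_ge0 ?addr_ge0// ltW.
apply: enorm_coord => [|i]; first exact: mulr_ge0.
have at0 : a <= a + t by rewrite lerDl.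
have := @ler_norm_derive R (fun s => phi s ord0 i) (fun s => C * s)
   (fun s => f (phi s) (uc (phi s)) ord0 i) (fun=> C) a (a + t) at0.
rewrite !mxE distrC -mulrBr [a + t]addrC addrK addrC; apply.
- apply: continuous_subspaceW ((within_continuous_coordP _ _).1 phiP.2.1 i).
  by move=> s /= /andP[/(le_trans a0) ->] /le_trans; apply.
- apply: (@within_continuous_derive _ _ _ (fun=> C)) => s _.
  by have := is_derive_mull C (is_derive_id s 1); rewrite mulr1.
- move=> s /andP[s0 st]; apply: (is_derive_coordP _ _ _).1.
  by apply: phiP.2.2; rewrite (le_lt_trans a0)//= (lt_le_trans st).
- by move=> s _; have := is_derive_mull C (is_derive_id s 1); rewrite mulr1.
- move=> s /andP[s0 st]; apply: le_trans (coord_le_enorm _ _) _.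
  have sb : enorm (phi s) <= b.
    by apply: phib; rewrite (le_trans a0 (ltW s0))//= (le_trans (ltW st)).
  have sM : enorm (phi s) <= M by rewrite (le_trans sb)// (le_trans _ bM)// lerDl.
  have M0' : enorm (0 : 'rV[R]_n) <= M by rewrite enorm0.
  have := fL sM M0' (ucM sM) (ucM M0'); rewrite uc0 f00 !subr0 => /le_trans; apply.
  have := ucL sM M0'; rewrite uc0 !subr0 => ucs.
  rewrite /C -!mulrA ler_wpM2l ?(ltW L0)// mulrDl mul1r lerD//.
  by rewrite (le_trans ucs)// ler_wpM2l// ltW.
Qed.

(** Gronwall for the difference of the held-input flow and the shifted solution. The error profile
    [c * (expR (Lam * t) - 1)] is reproduced with the same [c], so that steps can be chained. *)
Lemma one_step_error (a tau tst eta c : R) (x : 'rV[R]_n) (u : 'rV[R]_m) psi :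
  0 <= a -> 0 <= tau -> tau <= tst -> a + tau <= T ->
  is_sol (fun z => f z u) x tau psi ->
  0 <= eta <= 1 -> enorm u <= Mu -> enorm (uc x - u) <= eta * enorm x ->
  0 < c -> c * expR (Lam * (a + tau)) <= 1 ->
  L * (eta + Lu * N * (L * (1 + Lu)) * tst) * b <= c ->
  (forall i, `|x ord0 i - phi a ord0 i| <= c * (expR (Lam * a) - 1)) ->
  forall i, `|psi tau ord0 i - phi (a + tau) ord0 i| <=
            c * (expR (Lam * (a + tau)) - 1).
Proof.
move=> a0 tau0 tst_ atT [psi0 [cpsi dpsi]] /andP[eta0 eta1] uMu ucu c0 c1 cb xa i.
have E1 : 1 <= expR (Lam * a) by rewrite -expR0 ler_expR mulr_ge0// growth_rate_ge0.
(* [A - A0] equals [c], the strict gap that Gronwall asks for. *)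
set A0 := c * (expR (Lam * a) - 1) in xa; pose A := c * expR (Lam * a).
have A00 : 0 <= A0 by rewrite mulr_ge0 ?subr_ge0// ltW.
have A0A : A0 < A by rewrite /A0 /A mulrBr mulr1 gtrBl.
have cA : c <= A by rewrite ler_peMr// ltW.
pose d t := psi t - phi (a + t).
have := @gronwall_coord R n d (fun t => f (psi t) u - f (phi (a + t)) (uc (phi (a + t))))
  tau A0 A Lam tau0 growth_rate_ge0 A00 A0A.
suff -> : c * (expR (Lam * (a + tau)) - 1) = A0 + A * (expR (Lam * tau) - 1).
  have -> : psi tau ord0 i - phi (a + tau) ord0 i = d tau ord0 i by rewrite !mxE.
  apply => //; last by rewrite tau0 lexx.
  - move=> t; apply: continuousB; first exact: cpsi.
    exact: (within_continuous_shift a0 atT phiP.2.1).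
  - move=> t /andP[t0 ttau]; apply: is_deriveB; first by apply: dpsi; rewrite t0.
    apply: is_derive_shift_row; apply: phiP.2.2.
    by rewrite ltr_wpDl//= (lt_le_trans _ atT)// ltrD2l.
  - by move=> j; have := xa j; rewrite /d addr0 psi0 !mxE.
  move=> t /andP[t0 ttau] dA j; set D := A * expR (Lam * t) in dA *.
  have AD : A <= D.
    rewrite ler_peMr ?(le_trans (ltW c0))// -expR0 ler_expR.
    by rewrite mulr_ge0 ?growth_rate_ge0// ltW.
  (* An error of at most 1 per coordinate has norm at most [N], which is the room left by [bM]: all
     states stay in the ball where [L] and [Lu] are valid. *)
  have D1 : D <= 1.
    apply: le_trans c1; rewrite /D /A -mulrA -expRD -mulrDr ler_wpM2l ?(ltW c0)//.
    by rewrite ler_expR ler_wpM2l ?growth_rate_ge0// lerD2l ltW.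
  have D0 : 0 <= D by rewrite (le_trans _ AD)// (le_trans _ cA)// ltW.
  clearbody D.
  have dN : enorm (psi t - phi (a + t)) <= N * D by exact: enorm_coord.
  have ND : N * D <= N by rewrite ler_piMr.
  have phit : enorm (phi (a + t)) <= b.
    by apply: phib; rewrite addr_ge0 ?(ltW t0)//= (le_trans _ atT)// lerD2l ltW.
  have phia : enorm (phi a) <= b by apply: phib; rewrite a0 (le_trans _ atT)// lerDl.
  have xN : enorm (x - phi a) <= N * D.
    apply: enorm_coord => // k; rewrite !mxE; apply: le_trans (xa k) _.
    exact: le_trans (ltW A0A) AD.
  have psiM : enorm (psi t) <= M.
    apply: le_trans (enorm_leD (psi t) (phi (a + t))) _.
    exact: le_trans (lerD phit (le_trans dN ND)) bM.
  have xbN : enorm x <= b + N * D by have := enorm_leD x (phi a); lra.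
  have xM : enorm x <= M by apply: le_trans xbN (le_trans _ bM); rewrite lerD2l.
  have bM' : b <= M by rewrite (le_trans _ bM)// lerDl.
  have phiM := le_trans phia bM'.
  have phitM := le_trans phit bM'.
  have ttT : a + t <= T by rewrite (le_trans _ atT)// lerD2l ltW.
  have var := sol_variation a0 (ltW t0) ttT.
  have {}var : enorm (phi a - phi (a + t)) <= N * (L * (1 + Lu) * b * tst).
    apply: le_trans var _; rewrite ler_wpM2l// ler_wpM2l ?(le_trans (ltW ttau))//.
    by rewrite !mulr_ge0 ?addr_ge0// ltW.
  (* Three sources: the discrete control against [uc] at [x], the state error at time [a], and the
     motion of the solution since the sampling instant. *)
  have udist : enorm (u - uc (phi (a + t))) <=
      eta * b + N * D + Lu * (N * D) + Lu * (N * (L * (1 + Lu) * b * tst)).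
    have := enorm_triangle u (uc x) (uc (phi (a + t))).
    have := enorm_triangle (uc x) (uc (phi a)) (uc (phi (a + t))).
    have := ucL xM phiM; have := ucL phiM phitM.
    have := ler_wpM2l (ltW Lu0) xN; have := ler_wpM2l (ltW Lu0) var.
    have : eta * enorm x <= eta * b + N * D.
      apply: le_trans (ler_wpM2l eta0 xbN) _; rewrite mulrDr lerD2l.
      by rewrite ler_piMl// mulr_ge0.
    rewrite (enormBC u (uc x)); lra.
  apply: le_trans (coord_le_enorm _ _) _.
  apply: le_trans (fL psiM phitM uMu (ucM phitM)) _.
  have := ler_wpM2l (ltW L0) dN; have := ler_wpM2l (ltW L0) udist.
  have : L * (eta + Lu * N * (L * (1 + Lu)) * tst) * b <= D.
    exact: le_trans cb (le_trans cA AD).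
  rewrite /Lam /growth_rate; lra.
by rewrite /A0 /A (mulrDr Lam) expRD; ring.
Qed.

End one_step.

(** * Sampled and continuous trajectories on a bounded horizon *)

Section closeness.
Context {R : realType} {n m : nat}.
Variables (f : 'rV[R]_n -> 'rV[R]_m -> 'rV[R]_n) (U : 'rV[R]_n -> R -> 'rV[R]_m).
Hypotheses (fP : assumption1 f) (ucP : assumption2 (fun x => U x 0)).
Hypothesis UP : StC (fun x (_ : R) => U x 0) U.

Let h := fun x => f x (U x 0).
Let Fb := fun x T => Fe f x (U x T) T.

Lemma StC_small (M eta : R) : 0 <= M -> 0 < eta ->
  exists2 del, 0 < del & forall x T, enorm x <= M -> 0 <= T < del ->
    enorm (U x 0 - U x T) <= eta * enorm x.
Proof.
move=> M0 eta0; have [rho [Ts [[[rho0 [crho _]] _] [Ts0 rhoP]]]] := UP M0.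
have [|del del0 drho] := (within_continuousP _ rho).1 crho 0 _ _ eta0.
  exact: lexx.
exists (Num.min Ts del); first by rewrite lt_min Ts0.
move=> x T xM /andP[T0]; rewrite lt_min => /andP[TTs Tdel].
apply: le_trans (rhoP x T xM T0 TTs) _; rewrite ler_wpM2r ?enorm_ge0//.
have : `|rho T - rho 0| <= eta by apply: drho => //; rewrite subr0 ger0_norm.
by rewrite rho0 subr0; apply: le_trans; exact: ler_norm.
Qed.

Lemma tsumS (Ts : nat -> R) k : tsum Ts k.+1 = tsum Ts k + Ts k.
Proof. exact: big_ord_recr. Qed.

Lemma tsum_ge0 tst (Ts : nat -> R) k : inPhi tst Ts -> 0 <= tsum Ts k.
Proof. by move=> TsP; apply: sumr_ge0 => i _; apply: ltW; case/andP: (TsP i). Qed.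

(** Chains [one_step_error] from a zero initial error. All constants depend on [B], [tau] and [eps]
    only, while the error scales with the actual bound [b]. *)
Lemma closeness_pos (B tau eps : R) : 0 < B -> 0 <= tau -> 0 < eps ->
  exists2 tst, 0 < tst & forall b x0 T phi, 0 < b <= B -> 0 <= T <= tau ->
    is_sol h x0 T phi -> (forall t, 0 <= t <= T -> enorm (phi t) <= b) ->
    forall Ts, inPhi tst Ts -> forall k, tsum Ts k <= T ->
      enorm (dt_sol Fb Ts x0 k - phi (tsum Ts k)) <= eps * b.
Proof.
move=> B0 tau0 eps0; pose N : R := n.+1%:R.
have N0 : 0 < N by [].
pose M := B + N; have M0 : 0 <= M by rewrite addr_ge0// ltW.
have [Lu [Lu0 ucL]] := ucP.2 M M0.
pose Mu := Lu * M + M.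
have Mu0 : 0 <= Mu by rewrite addr_ge0// mulr_ge0// ltW.
have [L [L0 fL]] := fP.2 M Mu M0 Mu0.
have ucM x : enorm x <= M -> enorm (U x 0) <= Lu * M.
  move=> xM; have := ucL x 0 xM; rewrite enorm0 ucP.1 !subr0 => /(_ M0)/le_trans.
  by apply; rewrite ler_wpM2l// ltW.
pose Lam := growth_rate L Lu N.
have Lam0 : 0 <= Lam by apply: growth_rate_ge0 => //; exact: ltW.
pose E := expR (Lam * tau); have E0 : 0 < E := expR_gt0 _.
(* The first term turns the final error into [eps], the second keeps [c * b * E] below 1 for every
   [b <= B]. *)
pose c := Num.min (eps / (N * E)) (B * E)^-1.
have c0 : 0 < c by rewrite lt_min divr_gt0 ?invr_gt0 ?mulr_gt0.
have ceps : N * (c * E) <= eps.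
  by rewrite mulrCA -ler_pdivlMr ?mulr_gt0// ge_min lexx.
have cB : c * B * E <= 1.
  by rewrite -mulrA -ler_pdivlMr ?mulr_gt0// div1r ge_min lexx orbT.
(* The budget [c] is split in half: [eta] spends one part on the control mismatch, [tst] below
   spends the other on the motion between samples. *)
pose eta := Num.min 1 (c / (2 * L)).
have eta0 : 0 < eta by rewrite lt_min ltr01 divr_gt0// mulr_gt0.
have eta1 : eta <= 1 by rewrite ge_min lexx.
have etaL : L * eta <= c / 2.
  have : eta <= c / (2 * L) by rewrite ge_min lexx orbT.
  by rewrite ler_pdivlMr ?mulr_gt0//; lra.
have [d1 d10 Ud] := StC_small M0 eta0.
have [d2 d20 fex] := local_existence fP M0 Mu0.
pose C := L * (Lu * N * (L * (1 + Lu))).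
have C0 : 0 < C by rewrite !mulr_gt0// addr_gt0.
pose tst := Num.min (Num.min d1 d2) (c / (2 * C)).
have tstC : C * tst <= c / 2.
  have : tst <= c / (2 * C) by rewrite ge_min lexx orbT.
  by rewrite ler_pdivlMr ?mulr_gt0//; lra.
exists tst; first by rewrite !lt_min d10 d20 divr_gt0// mulr_gt0.
move=> b x0 T phi /andP[b0 bB] /andP[T0 Ttau] phiP phib Ts TsP k.
have cb0 : 0 < c * b by exact: mulr_gt0.
have grow t : t <= T -> (c * b) * expR (Lam * t) <= c * b * E.
  move=> tT; rewrite ler_wpM2l ?(ltW cb0)// ler_expR ler_wpM2l//.
  exact: le_trans Ttau.
have cbE1 : c * b * E <= 1.
  by apply: le_trans cB; rewrite ler_wpM2r ?(ltW E0)// ler_wpM2l// ltW.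
have err : tsum Ts k <= T -> forall i,
    `|dt_sol Fb Ts x0 k ord0 i - phi (tsum Ts k) ord0 i| <=
    c * b * (expR (Lam * tsum Ts k) - 1).
  elim: k => [_ i|k IH kT i].
    by rewrite /tsum big_ord0 mulr0 expR0 subrr mulr0 phiP.1 subrr normr0.
  have /andP[Tk0 Tktst] := TsP k.
  move: kT; rewrite tsumS => kT; have k0 := tsum_ge0 k TsP.
  have kT' : tsum Ts k <= T by rewrite (le_trans _ kT)// lerDl ltW.
  have {}IH := IH kT'; set x := dt_sol Fb Ts x0 k in IH *.
  set a := tsum Ts k in k0 kT kT' IH *.
  have xM : enorm x <= M.
    have xN : enorm (x - phi a) <= N * 1.
      apply: enorm_le_coord => // j; rewrite !mxE; apply: le_trans (IH j) _.
      rewrite mulrBr mulr1 lerBlDr (le_trans (grow _ kT'))// (le_trans cbE1)//.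
      by rewrite lerDl ltW.
    apply: le_trans (enorm_leD x (phi a)) _; rewrite mulr1 in xN; apply: lerD => //.
    by apply: le_trans bB; apply: phib; rewrite k0.
  move: Tktst; rewrite !lt_min => /andP[/andP[Tkd1 Tkd2] TkC].
  have Ux : enorm (U x 0 - U x (Ts k)) <= eta * enorm x by apply: Ud; rewrite // ltW.
  have uMu : enorm (U x (Ts k)) <= Mu.
    apply: le_trans (enorm_leD _ (U x 0)) _; rewrite enormBC lerD ?ucM//.
    by rewrite (le_trans Ux)// (le_trans _ xM)// ler_piMl// enorm_ge0.
  have [|psi psiP psiT] := @FeP R n m f x (U x (Ts k)) (Ts k).
    by apply: fex; rewrite // ltW.
  rewrite /= -/x {1}/Fb -psiT.
  apply: (@one_step_error R n m f (fun x => U x 0) M Mu L Lu N (ltW N0) L0 Lu0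
    fP.1 ucP.1 fL ucL _ _ phi x0 T b (ltW b0) _ phiP phib a (Ts k) tst eta (c * b)
    x (U x (Ts k))) => //.
  - by move=> y c1; exact: enorm_le_coord.
  - by move=> y /ucM/le_trans; apply; rewrite lerDl.
  - by rewrite lerD2r.
  - exact: ltW.
  - by rewrite !le_min !ltW.
  - by rewrite ltW.
  - exact: le_trans (grow _ kT) cbE1.
  - rewrite ler_wpM2r ?(ltW b0)//; have -> : c = c / 2 + c / 2 by rewrite -splitr.
    by rewrite mulrDr mulrA -/C lerD.
move=> kT; apply: le_trans (_ : N * (c * b * E) <= _).
  apply: enorm_le_coord => [|i]; first by rewrite mulr_ge0// ltW.
  rewrite !mxE; apply: le_trans (err kT i) _.
  by rewrite mulrBr mulr1 lerBlDr (le_trans (grow _ kT))// lerDl ltW.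
by rewrite (mulrAC c) mulrA ler_wpM2r// ltW.
Qed.

(** The case [b = 0] is reached by enlarging [b] slightly and letting the enlargement tend to 0;
    hence the constants are taken for [B + 1]. *)
Lemma closeness (B tau eps : R) : 0 <= B -> 0 <= tau -> 0 < eps ->
  exists2 tst, 0 < tst & forall b x0 T phi, 0 <= b <= B -> 0 <= T <= tau ->
    is_sol h x0 T phi -> (forall t, 0 <= t <= T -> enorm (phi t) <= b) ->
    forall Ts, inPhi tst Ts -> forall k, tsum Ts k <= T ->
      enorm (dt_sol Fb Ts x0 k - phi (tsum Ts k)) <= eps * b.
Proof.
move=> B0 tau0 eps0; have B1 : 0 < B + 1 by rewrite ltr_wpDl.
have [tst tst0 cl] := closeness_pos B1 tau0 eps0.
exists tst => // b x0 T phi /andP[b0 bB] TT phiP phib Ts TsP k kT.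
apply/ler_addgt0Pr => e e0; pose e' := Num.min 1 (e / eps).
have e'0 : 0 < e' by rewrite lt_min ltr01 divr_gt0.
have e'1 : e' <= 1 by rewrite ge_min lexx.
have e'e : eps * e' <= e by rewrite mulrC -ler_pdivlMr// ge_min lexx orbT.
apply: le_trans (cl (b + e') x0 T phi _ TT phiP _ Ts TsP k kT) _.
- by rewrite ltr_wpDl//= lerD.
- by move=> t /phib/le_trans; apply; rewrite lerDl ltW.
- by rewrite mulrDr lerD2l.
Qed.

End closeness.

(** * Restarting and stopping sampled trajectories *)

Section discrete_time.
Context {R : realType} {n : nat}.
Implicit Types (Fb : 'rV[R]_n -> R -> 'rV[R]_n) (Ts : nat -> R).

Lemma dt_solD Fb Ts x0 j k :
  dt_sol Fb Ts x0 (j + k) = dt_sol Fb (fun i => Ts (j + i)%N) (dt_sol Fb Ts x0 j) k.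
Proof. by elim: k => [|k IH]; rewrite ?addn0// addnS /= IH. Qed.

Lemma tsumD Ts j k : tsum Ts (j + k) = tsum Ts j + tsum (fun i => Ts (j + i)%N) k.
Proof. exact: big_split_ord. Qed.

Lemma inPhi_le (T1 T2 : R) Ts : T1 <= T2 -> inPhi T1 Ts -> inPhi T2 Ts.
Proof.
by move=> T12 TsP i; have /andP[-> /lt_le_trans] := TsP i; apply.
Qed.

(** Steps are shorter than 1, so the first sampling instant past [tau] overshoots by at most 1. It
    has positive index, which makes induction on the remaining steps possible. *)
Lemma first_passage (tau : R) Ts k : 0 < tau -> inPhi 1 Ts -> tau < tsum Ts k ->
  exists2 j, (0 < j <= k)%N & tau <= tsum Ts j <= tau + 1.
Proof.
move=> tau0 TsP tauk; have ex : exists j, tau <= tsum Ts j by exists k; exact: ltW.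
have [j tauj minj] := ex_minnP ex.
case: j => [|j] in tauj minj *.
  by move: tauj; rewrite /tsum big_ord0 leNgt tau0.
exists j.+1; first by rewrite /= minj// ltW.
rewrite tauj tsumS lerD//; last by have /andP[_ /ltW] := TsP j.
by rewrite leNgt; apply/negP => /ltW/minj; rewrite ltnn.
Qed.

End discrete_time.

(** * Elementary properties of KL functions *)

Section class_KL.
Context {R : realType}.
Variables (b : R -> R -> R).
Hypothesis bKL : classKL b.

Lemma classKL_homo (r s t : R) : 0 <= r -> r <= s -> 0 <= t -> b r t <= b s t.
Proof.
move=> r0; rewrite le_eqVlt => /predU1P[->//|rs] t0.
by have [_ [_ /(_ _ _ r0 rs)/ltW]] := bKL.2.1 t t0.
Qed.

Lemma classKL_ge0 (r t : R) : 0 <= r -> 0 <= t -> 0 <= b r t.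
Proof.
by move=> r0 t0; have [<- _] := bKL.2.1 t t0; exact: classKL_homo.
Qed.

Lemma classKL_small (r e : R) : 0 <= r -> 0 < e ->
  exists2 tau, 0 < tau & forall t, tau <= t -> b r t <= e.
Proof.
move=> r0 e0; have [_ /cvgrPdist_le/(_ e e0)[A [_ bA]]] := bKL.2.2 r r0.
exists (Num.max A 0 + 1); first by rewrite ltr_wpDl// le_max lexx orbT.
move=> t tau; have At : A < t.
  by rewrite (lt_le_trans _ tau)// (@le_lt_trans _ _ (Num.max A 0)) ?le_max ?lexx// ltrDl.
by have := bA t At; rewrite sub0r normrN; apply: le_trans; exact: ler_norm.
Qed.

End class_KL.

(** * Transfer of stability in both directions *)

Section stability_transfer.
Context {R : realType} {n m : nat}.
Variables (f : 'rV[R]_n -> 'rV[R]_m -> 'rV[R]_n) (U : 'rV[R]_n -> R -> 'rV[R]_m).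
Hypotheses (fP : assumption1 f) (ucP : assumption2 (fun x => U x 0)).
Hypothesis UP : StC (fun x (_ : R) => U x 0) U.

Let h := fun x => f x (U x 0).
Let Fb := fun x T => Fe f x (U x T) T.

(** By compactness of the time interval. It supplies the bound for [closeness] when no stability of
    the continuous system is known yet. *)
Lemma is_sol_bounded x0 T phi : is_sol h x0 T phi ->
  exists2 B, 0 <= B & forall t, 0 <= t <= T -> enorm (phi t) <= B.
Proof.
move=> [_ [cphi _]].
have /compact_bounded[M [_ phiM]] :=
  continuous_compact cphi (@segment_compact _ 0 T).
have M1 : M < `|M| + 1 by rewrite (le_lt_trans (ler_norm M))// ltrDl.
exists (n.+1%:R * (`|M| + 1)); first by rewrite mulr_ge0// addr_ge0.
move=> t tT; apply: enorm_le_coord => [|i]; first by rewrite addr_ge0.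
by apply: le_trans (coord_le_norm _ i) (phiM _ M1 _ _); exists t.
Qed.

Lemma sol_approx x0 T phi t (tst e : R) : 0 <= t <= T -> is_sol h x0 T phi ->
  0 < tst -> 0 < e -> exists Ts k, [/\ inPhi tst Ts, tsum Ts k = t &
    enorm (phi t) <= enorm (dt_sol Fb Ts x0 k) + e].
Proof.
move=> tT phiP tst0 e0; have [B B0 phiB] := is_sol_bounded phiP.
have T0 : 0 <= T by case/andP: tT => /le_trans; apply.
have eps0 : 0 < e / (B + 1) by rewrite divr_gt0// ltr_wpDl.
have [tst' tst'0 cl] := closeness fP ucP UP B0 T0 eps0.
pose d := Num.min tst tst'; have d0 : 0 < d by rewrite lt_min tst0.
have [Ts [k [TsP Tsk]]] : exists Ts k, inPhi d Ts /\ tsum Ts k = t.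
  (* For [t = 0] no step is taken and the sequence only has to be admissible; otherwise [t] is cut
     into equal steps shorter than [d]. *)
  case/andP: tT; rewrite le_eqVlt => /predU1P[<- _|t0 _].
    exists (fun=> d / 2), 0%N; split; last by rewrite /tsum big_ord0.
    by move=> i; rewrite divr_gt0//= gtr_pMr// invf_lt1// ltr1n.
  pose k := Num.truncn (t / d); have tdk : t / d < k.+1%:R by exact: truncnS_gt.
  exists (fun=> t / k.+1%:R), k.+1; split.
    by move=> i; rewrite divr_gt0//= ltr_pdivrMr// mulrC -ltr_pdivrMr.
  by rewrite /tsum sumr_const card_ord -[LHS]mulr_natr divfK.
exists Ts, k; split=> //; first by apply: inPhi_le TsP; rewrite ge_min lexx.
rewrite -Tsk in tT *; have kT : tsum Ts k <= T by case/andP: tT.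
have TsP' : inPhi tst' Ts by apply: inPhi_le TsP; rewrite ge_min lexx orbT.
have := cl B x0 T phi _ _ phiP phiB Ts TsP' k kT.
rewrite B0 T0 !lexx => /(_ isT isT) dist.
apply: le_trans (enorm_leD _ (dt_sol Fb Ts x0 k)) _; rewrite lerD2l enormBC.
by rewrite (le_trans dist)// mulrAC ler_pdivrMr ?ltr_wpDl// ler_wpM2l ?(ltW e0)// lerDl.
Qed.

(** The bound [c] is tied to the elapsed time and not to the number of steps, so it survives
    refinement of the sampling. The constants of a discrete estimate thus carry over unchanged. *)
Lemma DT_CT_bound x0 T phi t (tst c : R) : 0 <= t <= T -> is_sol h x0 T phi ->
  0 < tst -> (forall Ts k, inPhi tst Ts -> tsum Ts k = t ->
    enorm (dt_sol Fb Ts x0 k) <= c) ->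
  enorm (phi t) <= c.
Proof.
move=> tT phiP tst0 bnd; apply/ler_addgt0Pr => e e0.
have [Ts [k [TsP Tsk dist]]] := sol_approx tT phiP tst0 e0.
by apply: le_trans dist _; rewrite lerD2r bnd.
Qed.

(* Over a time [tau] in which the continuous-time bound contracts by 1/4, the
   sampled solution follows it up to [enorm x0 / 4], hence contracts by 1/2;
   the decay rate comes from iterating these halvings. *)
Lemma CT_DT_exponential (K lam : R) : 1 <= K -> 0 < lam ->
  exists K' lam', [/\ 1 <= K', 0 < lam' & forall r, 0 <= r ->
    (forall x0 T phi, enorm x0 <= r -> 0 <= T -> is_sol h x0 T phi ->
      forall t, 0 <= t <= T -> enorm (phi t) <= K * enorm x0 * expR (- lam * t)) ->
    exists Tst, 0 < Tst /\ forall k Ts x0, inPhi Tst Ts -> enorm x0 <= r ->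
      enorm (dt_sol Fb Ts x0 k) <= K' * enorm x0 * expR (- lam' * tsum Ts k)].
Proof.
move=> K1 lam0; have K0 : 0 < K by exact: lt_le_trans K1.
pose tau := ln (4 * K) / lam.
have tau0 : 0 < tau by rewrite divr_gt0// ln_gt0//; lra.
have tauK : K * expR (- lam * tau) = 4^-1.
  have -> : - lam * tau = - ln (4 * K) by rewrite mulNr mulrC divfK// gt_eqF.
  rewrite expRN lnK ?posrE ?mulr_gt0//.
  by field; rewrite gt_eqF.
have tau10 : 0 < tau + 1 by rewrite addr_gt0.
(* A halving may take up to [tau + 1], because first passage overshoots. *)
pose lam' := ln 2 / (tau + 1).
have lam'0 : 0 < lam' by rewrite divr_gt0// ln_gt0// ltr1n.
have half s : s <= tau + 1 -> 1 <= 2 * expR (- lam' * s).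
  move=> stau; rewrite -ler_pdivrMl// mulr1 -[leLHS]lnK ?posrE// ler_expR.
  by rewrite lnV ?posrE// mulNr lerN2 /lam' mulrAC ler_pdivrMr// ler_wpM2l// ln_ge0// ler1n.
(* The factor 2 undoes the decay within one horizon. Neither constant depends on [r], as the
   semiglobal statement requires. *)
exists (2 * (K + 1)), lam'; split=> //; first by lra.
move=> r r0 phiP; have eps0 : 0 < (4 * K)^-1 by rewrite invr_gt0 mulr_gt0.
have [tst tst0 cl] := closeness fP ucP UP (mulr_ge0 (ltW K0) r0) (ltW tau10) eps0.
exists (Num.min tst 1); split; first by rewrite lt_min tst0 ltr01.
have near_sol Ts x0 k : inPhi (Num.min tst 1) Ts -> enorm x0 <= r ->
    tsum Ts k <= tau + 1 ->
    enorm (dt_sol Fb Ts x0 k) <=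
    K * enorm x0 * expR (- lam * tsum Ts k) + 4^-1 * enorm x0.
  move=> TsP x0r ktau; have x00 := enorm_ge0 x0.
  have bound T phi : 0 <= T -> is_sol h x0 T phi ->
      forall t, 0 <= t <= T -> enorm (phi t) <= K * enorm x0.
    move=> T0 phi_ t tT; apply: le_trans (phiP _ _ _ x0r T0 phi_ t tT) _.
    rewrite ler_piMr ?mulr_ge0 ?(ltW K0)// -expR0 ler_expR mulNr oppr_le0.
    by rewrite mulr_ge0 ?(ltW lam0)//; case/andP: tT.
  (* The stability estimate doubles as the a priori bound that makes the solution exist on the whole
     horizon. *)
  have [phi phi_] := apriori_existence (closed_loop_lipschitz fP ucP) bound (ltW tau10).
  have TsP' : inPhi tst Ts by apply: inPhi_le TsP; rewrite ge_min lexx.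
  have := cl (K * enorm x0) x0 (tau + 1) phi _ _ phi_ (bound _ _ (ltW tau10) phi_)
    Ts TsP' k ktau.
  rewrite mulr_ge0 ?(ltW K0)//= ler_wpM2l ?(ltW K0)//= (ltW tau10) lexx => /(_ isT isT).
  have -> : (4 * K)^-1 * (K * enorm x0) = 4^-1 * enorm x0 by field; rewrite gt_eqF.
  move=> dist; apply: le_trans (enorm_leD _ (phi (tsum Ts k))) (lerD _ dist).
  by apply: phiP phi_ _ _ => //; [exact: ltW|rewrite (tsum_ge0 _ TsP)].
(* Strong induction on the number of steps, general in the sequence and the initial state so that it
   can restart from the state reached. *)
move=> k; have [p] := ubnP k; elim: p k => // p IH k; rewrite ltnS => kp Ts x0 TsP x0r.
have x00 := enorm_ge0 x0.
have [ktau|tauk] := leP (tsum Ts k) (tau + 1).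
  apply: le_trans (near_sol _ _ _ TsP x0r ktau) _.
  have e1 : expR (- lam * tsum Ts k) <= 1.
    by rewrite -expR0 ler_expR mulNr oppr_le0 mulr_ge0 ?(ltW lam0) ?(tsum_ge0 _ TsP).
  have Kx0 : 0 <= K * enorm x0 by rewrite mulr_ge0// ltW.
  have := ler_wpM2l Kx0 e1.
  have := ler_wpM2l (addr_ge0 Kx0 x00) (half _ ktau).
  lra.
have TsP1 : inPhi 1 Ts by apply: inPhi_le TsP; rewrite ge_min lexx orbT.
have [|j /andP[j0 jk] /andP[tauj jtau]] := first_passage tau0 TsP1 (k := k).
  by rewrite (lt_trans _ tauk)// ltrDl.
have xj : enorm (dt_sol Fb Ts x0 j) <= 2^-1 * enorm x0.
  apply: le_trans (near_sol _ _ _ TsP x0r jtau) _.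
  have : expR (- lam * tsum Ts j) <= expR (- lam * tau).
    by rewrite ler_expR !mulNr lerN2 ler_wpM2l// ltW.
  move=> /(ler_wpM2l (ltW K0)); rewrite tauK => /(ler_wpM2l x00); lra.
rewrite -(subnKC jk) dt_solD tsumD.
set Ts' := fun i => Ts (j + i)%N; set y := dt_sol Fb Ts x0 j in xj *.
apply: le_trans (IH (k - j)%N _ Ts' y _ _) _.
- by rewrite (leq_trans _ kp)// ltn_subrL j0 (leq_trans j0).
- by move=> i; exact: TsP.
- by apply: le_trans xj _; lra.
(* The state reached is at most half of [enorm x0], and by [half] the decay factor up to step [j] is
   at least one half. *)
rewrite (mulrDr (- lam')) expRD -!mulrA ler_wpM2l// ler_wpM2l ?addr_ge0 ?(ltW K0)//.
rewrite mulrA; apply: ler_wpM2r; first exact: expR_ge0.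
have := ler_wpM2l x00 (half _ jtau); lra.
Qed.

(* The sampled solution follows the continuous one until it is so small that the
   local exponential estimate takes over; the same KL function serves. *)
Lemma GAS_LES_VSR_SPS_VSR : GAS h -> LES_VSR Fb -> SPS_VSR Fb.
Proof.
move=> [b [bKL phib]] [K [r [tl [lam [K1 [r0 [tl0 [lam0 les]]]]]]]].
have K0 : 0 < K by exact: lt_le_trans K1.
exists b; split=> // M e M0 e0.
(* Within [del] of the origin the local estimate applies and keeps the state below [e]. One half of
   [del] goes to the KL bound at time [tau], the other to the sampling error. *)
pose del := Num.min r (e / K); have del0 : 0 < del by rewrite lt_min r0 divr_gt0.
have del20 : 0 < del / 2 by rewrite divr_gt0.
have delr : del <= r by rewrite ge_min lexx.
have Kdel : K * del <= e by rewrite mulrC -ler_pdivlMr// ge_min lexx orbT.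
have dele : del <= e by apply: le_trans Kdel; rewrite ler_peMl// ltW.
have [tau tau0 btau] := classKL_small bKL M0 del20.
have tau10 : 0 < tau + 1 by rewrite addr_gt0.
pose B := b M 0 + 1.
have B0 : 0 < B by rewrite ltr_wpDl// (classKL_ge0 bKL).
have [tst tst0 cl] := closeness fP ucP UP (ltW B0) (ltW tau10) (divr_gt0 del20 B0).
exists (Num.min (Num.min tst tl) 1); split; first by rewrite !lt_min tst0 tl0 ltr01.
move=> k Ts x0 TsP x0M; have x00 := enorm_ge0 x0.
have TsP1 : inPhi 1 Ts by apply: inPhi_le TsP; rewrite ge_min lexx orbT.
have TsPt : inPhi tst Ts by apply: inPhi_le TsP; rewrite !ge_min lexx.
have TsPl : inPhi tl Ts by apply: inPhi_le TsP; rewrite !ge_min lexx orbT.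
have near_sol j : tsum Ts j <= tau + 1 ->
    enorm (dt_sol Fb Ts x0 j) <= b (enorm x0) (tsum Ts j) + del / 2.
  move=> jtau.
  have bound T phi : 0 <= T -> is_sol h x0 T phi ->
      forall t, 0 <= t <= T -> enorm (phi t) <= B.
    move=> T0 phi_ t tT; apply: le_trans (phib _ _ _ T0 phi_ t tT) _.
    case/andP: tT => t0 _; have [bt _] := bKL.2.2 _ x00.
    apply: le_trans (bt 0 t (lexx 0) t0) _.
    by apply: le_trans (classKL_homo bKL x00 x0M (lexx 0)) _; rewrite lerDl.
  have [phi phi_] := apriori_existence (closed_loop_lipschitz fP ucP) bound (ltW tau10).
  have := cl B x0 (tau + 1) phi _ _ phi_ (bound _ _ (ltW tau10) phi_) Ts TsPt j jtau.
  rewrite (ltW B0) (ltW tau10) !lexx divfK ?gt_eqF// => /(_ isT isT) dist.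
  apply: le_trans (enorm_leD _ (phi (tsum Ts j))) (lerD _ dist).
  by apply: phib phi_ _ _ => //; [exact: ltW|rewrite (tsum_ge0 _ TsP)].
have bk0 : 0 <= b (enorm x0) (tsum Ts k) by rewrite (classKL_ge0 bKL)// (tsum_ge0 _ TsP).
have [ktau|tauk] := leP (tsum Ts k) (tau + 1).
  by apply: le_trans (near_sol k ktau) _; lra.
have [|j /andP[j0 jk] /andP[tauj jtau]] := first_passage tau0 TsP1 (k := k).
  by rewrite (lt_trans _ tauk)// ltrDl.
have xj : enorm (dt_sol Fb Ts x0 j) <= del.
  apply: le_trans (near_sol j jtau) _; have := btau _ tauj.
  have := classKL_homo bKL x00 x0M (tsum_ge0 j TsP); lra.
(* Past the first passage the offset [e] alone bounds the state. *)
apply: le_trans (_ : e <= _); last by rewrite lerDr.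
rewrite -(subnKC jk) dt_solD.
set Ts' := fun i => Ts (j + i)%N; set y := dt_sol Fb Ts x0 j in xj *.
have TsP' : inPhi tl Ts' by move=> i; exact: TsPl.
apply: le_trans (les _ Ts' y TsP' (le_trans xj delr)) (le_trans _ Kdel).
apply: le_trans (_ : K * enorm y <= _); last by rewrite ler_wpM2l// ltW.
rewrite ler_piMr ?mulr_ge0 ?enorm_ge0 ?(ltW K0)// -expR0 ler_expR mulNr oppr_le0.
by rewrite mulr_ge0 ?(ltW lam0) ?(tsum_ge0 _ TsP').
Qed.

Lemma LES_iff_LES_VSR : LES h <-> LES_VSR Fb.
Proof.
split=> [[K [r [lam [K1 [r0 [lam0 les]]]]]]|[K [r [tst [lam [K1 [r0 [tst0 [lam0 les]]]]]]]]].
  have [K' [lam' [K'1 lam'0 /(_ r (ltW r0) les)[tst [tst0 vsr]]]]] :=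
    CT_DT_exponential K1 lam0.
  by exists K', r, tst, lam'.
exists K, r, lam; do 3!split=> //; move=> x0 T phi x0r T0 phi_ t tT.
by apply: (DT_CT_bound tT phi_ tst0) => Ts k TsP <-; exact: les.
Qed.

(** The offset is arbitrary for each fixed initial state and is sent to 0, while the KL function
    does not depend on it. *)
Lemma SPS_VSR_GAS : SPS_VSR Fb -> GAS h.
Proof.
move=> [b [bKL sps]]; exists b; split=> // x0 T phi T0 phi_ t tT.
apply/ler_addgt0Pr => e e0; have [tst [tst0 xk]] := sps _ _ (enorm_ge0 x0) e0.
by apply: (DT_CT_bound tT phi_ tst0) => Ts k TsP <-; exact: xk.
Qed.

Lemma GES_iff_SES_VSR : GES h <-> SES_VSR Fb.
Proof.
split=> [[K [lam [K1 [lam0 ges]]]]|[K [lam [K1 [lam0 ses]]]]].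
  have [K' [lam' [K'1 lam'0 vsr]]] := CT_DT_exponential K1 lam0.
  exists K', lam'; do 2!split=> //; move=> M M0; apply: vsr => // x0 T phi _.
  exact: ges.
exists K, lam; do 2!split=> //; move=> x0 T phi T0 phi_ t tT.
have [tst [tst0 xk]] := ses _ (enorm_ge0 x0).
by apply: (DT_CT_bound tT phi_ tst0) => Ts k TsP <-; exact: xk.
Qed.

End stability_transfer.

Theorem theorem3 (R : realType) (n m : nat)
  (f : 'rV[R]_n -> 'rV[R]_m -> 'rV[R]_n) (U : 'rV[R]_n -> R -> 'rV[R]_m) :
  assumption1 f ->
  assumption2 (fun x => U x 0) ->
  StL U ->
  StC (fun x (_ : R) => U x 0) U ->
  let h := fun x => f x (U x 0) in
  let Fb := fun x T => Fe f x (U x T) T in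
  (LES h <-> LES_VSR Fb) /\
  (GALES h <-> SLES_VSR Fb) /\
  (GES h <-> SES_VSR Fb).
Proof.
move=> fP ucP _ UP h Fb.
have les := LES_iff_LES_VSR fP ucP UP.
split=> //; split; last exact: GES_iff_SES_VSR.
split=> [[gas /les vsr]|[sps /les ?]]; split=> //.
  exact: GAS_LES_VSR_SPS_VSR.
exact: SPS_VSR_GAS sps.
Qed.
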